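(* Assume the standing setting of the context. Let $(\varepsilon_k)_k$ be a positive sequence with $\varepsilon_k\to0$ and let $x^*(\varepsilon_k)$ be the unique Nash equilibrium of NEP($\varepsilon_k$). Assume $x^*(\varepsilon_k)\to\bar x$ and that for every $\nu$, MPCC-CRCQ holds for the problem MPCC$_\nu$ (with $x_{-\nu}=\bar x_{-\nu}$) at the point $(\bar x_\nu,\bar y)$, where $\bar y=\max\{Q_y^{-1}B^\top\bar x,L^\top\bar x\}$. Then for every $\nu$ there exists a bounded sequence $(\lambda^k_\nu)_k$ of Lagrange multipliers associated with $x^*(\varepsilon_k)$, i.e. $\lambda^k_\nu\in\mathbb{R}^{m_\nu}$ with $$0=Q_\nu x_\nu+c_\nu+\tfrac12\big((L^\top+Q_y^{-1}B^\top)^\top a\big)_\nu+\tfrac12\sum_{i=1}^m a_i\big((L^\top-Q_y^{-1}B^\top)_{i,:}\big)^\top_\nu\,\tilde\phi_\varepsilon'\big([(L^\top-Q_y^{-1}B^\top)x]_i\big)+\nabla_{x_\nu}g_\nu(x_\nu)\lambda_\nu,\quad 0=\min\{\lambda_\nu,-g_\nu(x_\nu)\}$$ at $x=x^*(\varepsilon_k)$, $\varepsilon=\varepsilon_k$, $\lambda_\nu=\lambda_\nu^k$ (where $(\cdot)_\nu$ denotes the components belonging to $x_\nu$); and for every $\nu=1,\dots,N$, the point $(\bar x_\nu,\bar y)$ is a strongly stationary point of MPCC$_\nu$ with $x_{-\nu}=\bar x_{-\nu}$.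
   Context: Standing setting: $N\ge1$, $x=(x_1,\dots,x_N)\in\mathbb{R}^n$, $x_\nu\in\mathbb{R}^{n_\nu}$. For each $\nu$: $Q_\nu\in\mathbb{R}^{n_\nu\times n_\nu}$ symmetric positive definite, $c_\nu\in\mathbb{R}^{n_\nu}$, $X_\nu=\{x_\nu:g_\nu(x_\nu)\le0\}$ nonempty, convex, closed, with $g_\nu:\mathbb{R}^{n_\nu}\to\mathbb{R}^{m_\nu}$ convex and at least twice differentiable; $a\in\mathbb{R}^m$, $a\ge0$; $Q_y\in\mathbb{R}^{m\times m}$ positive definite diagonal; $B,L\in\mathbb{R}^{n\times m}$. For $\varepsilon>0$, $\tilde\phi_\varepsilon:\mathbb{R}\to\mathbb{R}$ is convex and at least twice differentiable (applied componentwise), such that $\phi_\varepsilon(\alpha,\beta)=\alpha+\beta-\tilde\phi_\varepsilon(\alpha-\beta)$ is a smooth NCP function, continuous in $\varepsilon$, approximating as $\varepsilon\to0$ the nonsmooth NCP function $\alpha+\beta-|\alpha-\beta|=2\min\{\alpha,\beta\}$ (example: $\tilde\phi_\varepsilon(t)=\sqrt{t^2+4\varepsilon^2}$). NEP($\varepsilon$): player $\nu$ solves $\min_{x_\nu\in X_\nu}\tfrac12 x_\nu^\top Q_\nu x_\nu+c_\nu^\top x_\nu+\tfrac12\sum_i a_i[(L^\top+Q_y^{-1}B^\top)x+\tilde\phi_\varepsilon((L^\top-Q_y^{-1}B^\top)x)]_i$; it has a unique Nash equilibrium $x^*(\varepsilon)$. MPCC$_\nu$ (with $x_{-\nu}$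 fixed): $\min_{(x_\nu,y)\in\mathbb{R}^{n_\nu}\times\mathbb{R}^m}\tfrac12 x_\nu^\top Q_\nu x_\nu+c_\nu^\top x_\nu+a^\top y$ s.t. $g_\nu(x_\nu)\le0$, $0=\min\{G_1,G_2\}$ componentwise, where $G_1(x_\nu,y)=y-Q_y^{-1}B^\top x$, $G_2(x_\nu,y)=y-L^\top x$, $x=(x_\nu,x_{-\nu})$. For a general MPCC $\min_z f(z)$ s.t. $g(z)\le0$, $0=\min\{G_1(z),G_2(z)\}$ with smooth $f,g:\mathbb{R}^p\to\mathbb{R}^{q}$, $G_1,G_2:\mathbb{R}^p\to\mathbb{R}^l$: a feasible $\bar z$ is strongly stationary if there exist $(\lambda,\Gamma_1,\Gamma_2)\in\mathbb{R}^{q+l+l}$ with $0=\nabla f(\bar z)+\sum_i\lambda_i\nabla g_i(\bar z)-\sum_i\Gamma_{1,i}\nabla G_{1,i}(\bar z)-\sum_i\Gamma_{2,i}\nabla G_{2,i}(\bar z)$, $\lambda\ge0$, $\lambda_ig_i(\bar z)=0$ for all $i$, $G_{1,i}(\bar z)\Gamma_{1,i}=0$, $G_{2,i}(\bar z)\Gamma_{2,i}=0$ for all $i$, and $\Gamma_{1,i},\Gamma_{2,i}\ge0$ for all $i$ with $G_{1,i}(\bar z)=G_{2,i}(\bar z)=0$. MPCC-CRCQ holds at a feasible $\bar z$ if for all $\mathcal K_g\subseteq\{i:g_i(\bar z)=0\}$, $\mathcal K_1\subseteq\{i:G_{1,i}(\bar z)=0\}$, $\mathcal K_2\subseteq\{i:G_{2,i}(\bar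 z)=0\}$ there is a neighborhood $U$ of $\bar z$ such that for all $z\in U$ the family $\{\nabla g_i(z)\}_{i\in\mathcal K_g}\cup\{\nabla G_{1,i}(z)\}_{i\in\mathcal K_1}\cup\{\nabla G_{2,i}(z)\}_{i\in\mathcal K_2}$ has the same rank as the corresponding family at $\bar z$.
   Formalization: The multipliers in the bounded sequence are required to satisfy the KKT system at $x^*(\varepsilon_k)$ only for all sufficiently large $k$: MPCC-CRCQ is assumed only at the limit point, and for finitely many early $k$ multipliers may fail to exist. *)

(* Defs.v *)
From HB Require Import structures.
From mathcomp Require Import all_boot all_order all_algebra.
From mathcomp Require Import all_classical all_reals all_analysis.
Set Implicit Arguments. Unset Strict Implicit. Unset Printing Implicit Defensive.
Import Order.TTheory GRing.Theory Num.Theory.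
Import numFieldNormedType.Exports.
Local Open Scope ring_scope.

Section Generic.
Variable R : realType.

Definition grad (p : nat) (h : 'rV[R]_p -> R) (z : 'rV[R]_p) : 'rV[R]_p :=
  \row_j ('D_(delta_mx 0 j) h z).

Definition compf (p q : nat) (F : 'rV[R]_p -> 'rV[R]_q) (i : 'I_q) : 'rV[R]_p -> R :=
  fun z => F z 0 i.

Definition mpcc_feasible (p q l : nat) (g : 'rV[R]_p -> 'rV[R]_q)
    (G1 G2 : 'rV[R]_p -> 'rV[R]_l) (z : 'rV[R]_p) : Prop :=
  (forall i, g z 0 i <= 0) /\ (forall i, Num.min (G1 z 0 i) (G2 z 0 i) = 0).

Definition strongly_stationary (p q l : nat) (f : 'rV[R]_p -> R)
    (g : 'rV[R]_p -> 'rV[R]_q) (G1 G2 : 'rV[R]_p -> 'rV[R]_l) (z : 'rV[R]_p) : Prop :=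
  mpcc_feasible g G1 G2 z /\
  exists (lam : 'rV[R]_q) (Ga1 Ga2 : 'rV[R]_l),
    grad f z + \sum_(i < q) lam 0 i *: grad (compf g i) z
      - \sum_(i < l) Ga1 0 i *: grad (compf G1 i) z
      - \sum_(i < l) Ga2 0 i *: grad (compf G2 i) z = 0
    /\ (forall i, 0 <= lam 0 i)
    /\ (forall i, lam 0 i * g z 0 i = 0)
    /\ (forall i, G1 z 0 i * Ga1 0 i = 0 /\ G2 z 0 i * Ga2 0 i = 0)
    /\ (forall i, G1 z 0 i = 0 -> G2 z 0 i = 0 -> 0 <= Ga1 0 i /\ 0 <= Ga2 0 i).

(* the family of gradients indexed by Kg, K1, K2, as the rows of a matrix
   (rows outside the index sets are zero, which does not change the rank) *)
Definition grad_family (p q l : nat) (g : 'rV[R]_p -> 'rV[R]_q)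
    (G1 G2 : 'rV[R]_p -> 'rV[R]_l) (Kg : {set 'I_q}) (K1 K2 : {set 'I_l})
    (w : 'rV[R]_p) : 'M[R]_(q + l + l, p) :=
  col_mx (col_mx (\matrix_(i < q) (if i \in Kg then grad (compf g i) w else 0))
                 (\matrix_(i < l) (if i \in K1 then grad (compf G1 i) w else 0)))
         (\matrix_(i < l) (if i \in K2 then grad (compf G2 i) w else 0)).

Definition MPCC_CRCQ (p q l : nat) (g : 'rV[R]_p -> 'rV[R]_q)
    (G1 G2 : 'rV[R]_p -> 'rV[R]_l) (z : 'rV[R]_p) : Prop :=
  mpcc_feasible g G1 G2 z /\
  forall (Kg : {set 'I_q}) (K1 K2 : {set 'I_l}),
    Kg \subset [set i | g z 0 i == 0] ->
    K1 \subset [set i | G1 z 0 i == 0] ->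
    K2 \subset [set i | G2 z 0 i == 0] ->
    \forall w \near z,
      \rank (grad_family g G1 G2 Kg K1 K2 w) = \rank (grad_family g G1 G2 Kg K1 K2 z).

Variables (N : nat) (nn : 'I_N -> nat) (m : nat).

Definition profile := forall nu : 'I_N, 'rV[R]_(nn nu).

(* B and L in R^{n x m} are given by their row blocks B nu, L nu in R^{n_nu x m};
   (B^T x)^T = sum_nu x_nu B_nu *)
Definition BTx (B : forall nu, 'M[R]_(nn nu, m)) (x : profile) : 'rV[R]_m :=
  \sum_(nu < N) x nu *m B nu.

Definition QyBTx (Qy : 'M[R]_m) (B : forall nu, 'M[R]_(nn nu, m)) (x : profile)
  : 'rV[R]_m := BTx B x *m (invmx Qy)^T.

Definition upd (x : profile) (nu : 'I_N) (y : 'rV[R]_(nn nu)) : profile :=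
  @dfwith _ (fun mu => 'rV[R]_(nn mu)) x nu y.

Definition theta (Q : forall nu, 'M[R]_(nn nu)) (c : forall nu, 'rV[R]_(nn nu))
    (a : 'rV[R]_m) (Qy : 'M[R]_m) (B L : forall nu, 'M[R]_(nn nu, m))
    (phit : R -> R -> R) (eps : R) (nu : 'I_N) (x : profile) : R :=
  2^-1 * (x nu *m Q nu *m (x nu)^T) 0 0 + (c nu *m (x nu)^T) 0 0
  + 2^-1 * \sum_(i < m) a 0 i *
      ((BTx L x + QyBTx Qy B x) 0 i + phit eps ((BTx L x - QyBTx Qy B x) 0 i)).

Definition is_NE (Q : forall nu, 'M[R]_(nn nu)) (c : forall nu, 'rV[R]_(nn nu))
    (mg : 'I_N -> nat) (g : forall nu, 'rV[R]_(nn nu) -> 'rV[R]_(mg nu))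
    (a : 'rV[R]_m) (Qy : 'M[R]_m) (B L : forall nu, 'M[R]_(nn nu, m))
    (phit : R -> R -> R) (eps : R) (x : profile) : Prop :=
  forall nu : 'I_N,
    (forall i, g nu (x nu) 0 i <= 0) /\
    forall y : 'rV[R]_(nn nu), (forall i, g nu y 0 i <= 0) ->
      theta Q c a Qy B L phit eps nu x
        <= theta Q c a Qy B L phit eps nu (upd x y).

(* ---------- MPCC_nu with x_{-nu} fixed to xb_{-nu}; variable z = (x_nu, y) ---------- *)
Definition mpcc_f (Q : forall nu, 'M[R]_(nn nu)) (c : forall nu, 'rV[R]_(nn nu))
    (a : 'rV[R]_m) (nu : 'I_N) (z : 'rV[R]_(nn nu + m)) : R :=
  2^-1 * (lsubmx z *m Q nu *m (lsubmx z)^T) 0 0 + (c nu *m (lsubmx z)^T) 0 0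
  + (a *m (rsubmx z)^T) 0 0.

Definition mpcc_g (mg : 'I_N -> nat) (g : forall nu, 'rV[R]_(nn nu) -> 'rV[R]_(mg nu))
    (nu : 'I_N) (z : 'rV[R]_(nn nu + m)) : 'rV[R]_(mg nu) :=
  g nu (lsubmx z).

Definition mpcc_G1 (Qy : 'M[R]_m) (B : forall nu, 'M[R]_(nn nu, m)) (xb : profile)
    (nu : 'I_N) (z : 'rV[R]_(nn nu + m)) : 'rV[R]_m :=
  rsubmx z - QyBTx Qy B (upd xb (lsubmx z)).

Definition mpcc_G2 (L : forall nu, 'M[R]_(nn nu, m)) (xb : profile)
    (nu : 'I_N) (z : 'rV[R]_(nn nu + m)) : 'rV[R]_m :=
  rsubmx z - BTx L (upd xb (lsubmx z)).

Definition ybar (Qy : 'M[R]_m) (B L : forall nu, 'M[R]_(nn nu, m)) (xb : profile)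
  : 'rV[R]_m := \row_i Num.max (QyBTx Qy B xb 0 i) (BTx L xb 0 i).

Definition NEP_KKT (Q : forall nu, 'M[R]_(nn nu)) (c : forall nu, 'rV[R]_(nn nu))
    (mg : 'I_N -> nat) (g : forall nu, 'rV[R]_(nn nu) -> 'rV[R]_(mg nu))
    (a : 'rV[R]_m) (Qy : 'M[R]_m) (B L : forall nu, 'M[R]_(nn nu, m))
    (phit : R -> R -> R) (eps : R) (nu : 'I_N) (x : profile) (lam : 'rV[R]_(mg nu))
    : Prop :=
  (* (L^T + Q_y^{-1}B^T) restricted to the nu-block, transposed: L_nu + B_nu Q_y^{-T} *)
  let Mp := L nu + B nu *m (invmx Qy)^T in
  (* (L^T - Q_y^{-1}B^T) restricted to the nu-block, transposed *)
  let Mm := L nu - B nu *m (invmx Qy)^T in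
  (Q nu *m (x nu)^T)^T + c nu + 2^-1 *: (Mp *m a^T)^T
  + 2^-1 *: \sum_(i < m) (a 0 i * derive1 (phit eps) ((BTx L x - QyBTx Qy B x) 0 i))
                         *: (col i Mm)^T
  + \sum_(i < mg nu) lam 0 i *: grad (compf (g nu) i) (x nu) = 0
  /\ (forall i, Num.min (lam 0 i) (- g nu (x nu) 0 i) = 0).

End Generic.

Arguments mpcc_f {R N nn m} Q c a nu z.
Arguments mpcc_g {R N nn m mg} g nu z.
Arguments mpcc_G1 {R N nn m} Qy B xb nu z.
Arguments mpcc_G2 {R N nn m} L xb nu z.

(* Main.v *)
Require Import Defs.
From HB Require Import structures.
From mathcomp Require Import all_boot all_order all_algebra.
From mathcomp Require Import all_classical all_reals all_analysis.
From mathcomp Require Import ring lra.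
Import Order.TTheory GRing.Theory Num.Theory.
Import numFieldNormedType.Exports.
Set Implicit Arguments.
Unset Strict Implicit.
Unset Printing Implicit Defensive.
Local Open Scope ring_scope.
Local Open Scope classical_set_scope.

(** The constant rank condition is used only for the constraint gradients
    (K1 and K2 empty).  Near the limit point, Caratheodory's reduction turns any
    nonnegative combination of active gradients into one with independent support
    and the same value; by constant rank that support stays independent at the
    limit point, so its coefficients are bounded by a fixed multiple of the norm of
    the value.

    At each equilibrium the objective is convex along feasible segments, so the
    equilibrium minimises a linear function over X_nu.  A quadratic penalty argument
    produces approximate multipliers at nearby points; after reduction they are
    bounded, and any limit is an exact multiplier with the same bound.  No implicit
    function theorem is needed.

    Convexity and pointwise convergence to |t| confine the limits psi_i of the
    slopes of phit to the subdifferential of |.| at the limit argument.  Passing to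
    the limit in the KKT system, the MPCC multipliers are
    Gamma_1 = a (1 - psi) / 2 and Gamma_2 = a (1 + psi) / 2.  All limits are taken
    along one ultrafilter, which replaces the extraction of subsequences. *)

(** * Reduction of multipliers under constant rank *)

(** Induction on the size of the support. If the rows in the support are dependent, subtracting a
    multiple of a relation [c] keeps the value; the step is stopped when the first coefficient
    reaches zero, so signs survive and the support shrinks. *)
Lemma conic_caratheodory (R : realType) (q n : nat) (V : 'M[R]_(q, n)) (mu : 'rV[R]_q) :
  (forall i, 0 <= mu 0 i) ->
  exists mu' : 'rV[R]_q, [/\ forall i, 0 <= mu' 0 i,
    forall i, mu 0 i = 0 -> mu' 0 i = 0, mu' *m V = mu *m V &
    forall c : 'rV[R]_q, (forall i, mu' 0 i = 0 -> c 0 i = 0) -> c *m V = 0 -> c = 0].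
Proof.
have [k] := ubnP #|[set i | mu 0 i != 0]|%SET.
elim: k mu => // k IH mu supp_mu mu_ge0.
have [indep|] := pselect (forall c : 'rV[R]_q,
    (forall i, mu 0 i = 0 -> c 0 i = 0) -> c *m V = 0 -> c = 0).
  by exists mu.
move=> /existsNP[c0 /not_implyP[c0supp /not_implyP[c0V /eqP c0N0]]].
(* The relation is negated if necessary, so that some entry is positive and the minimal ratio below
   is taken over a nonempty set. *)
have [c [csupp cV [i0 ci0]]] : exists c : 'rV[R]_q,
    [/\ forall i, mu 0 i = 0 -> c 0 i = 0, c *m V = 0 & exists i, 0 < c 0 i].
  have /rV0Pn[i c0i] := c0N0.
  have [c0i_lt0|c0i_gt0|c0i_eq0] := ltgtP (c0 0 i) 0.
  - exists (- c0); split; last by exists i; rewrite mxE oppr_gt0.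
    + by move=> j /c0supp c0j; rewrite mxE c0j oppr0.
    + by rewrite mulNmx c0V oppr0.
  - by exists c0; split => //; exists i.
  - by rewrite c0i_eq0 eqxx in c0i.
pose i1 := [arg min_(i < i0 | 0 < c 0 i) (mu 0 i / c 0 i)]%O.
have [ci1 i1min] : 0 < c 0 i1 /\ forall j, 0 < c 0 j -> mu 0 i1 / c 0 i1 <= mu 0 j / c 0 j.
  by rewrite /i1; case: arg_minP.
(* the largest step along - c that keeps the coefficients nonnegative *)
pose t := mu 0 i1 / c 0 i1.
have t_ge0 : 0 <= t by rewrite divr_ge0 // ltW.
pose nu := mu - t *: c.
have nuE i : nu 0 i = mu 0 i - t * c 0 i by rewrite !mxE.
have nu_ge0 i : 0 <= nu 0 i.
  rewrite nuE subr_ge0; have [ci_gt0|ci_le0] := ltP 0 (c 0 i).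
    by rewrite -ler_pdivlMr // i1min.
  by apply: le_trans (mu_ge0 i); rewrite mulr_ge0_le0.
have nu_supp i : mu 0 i = 0 -> nu 0 i = 0.
  by move=> mui; rewrite nuE mui csupp // mulr0 subr0.
have nui1 : nu 0 i1 = 0 by rewrite nuE /t divfK ?subrr // gt_eqF.
have [|mu' [mu'_ge0 mu'supp mu'V mu'ind]] := IH nu _ nu_ge0.
  rewrite -ltnS; apply: leq_trans supp_mu; rewrite ltnS; apply: proper_card.
  apply/properP; split.
    apply/fintype.subsetP => i; rewrite !inE; apply: contra_neq; exact: nu_supp.
  exists i1; rewrite !inE ?nui1 ?eqxx //; apply/eqP => /csupp ci10.
  by rewrite ci10 ltxx in ci1.
exists mu'; split => //; first by move=> i /nu_supp; exact: mu'supp.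
by rewrite mu'V mulmxBl -scalemxAl cV scaler0 subr0.
Qed.

(** Multiplying on the left by this matrix zeroes the rows outside [K] without changing the format.
    Independence of the rows of [V] in [K] then reads as equality of the ranks of
    [indic_diag R K *m V] and [indic_diag R K]. *)
Definition indic_diag (R : realType) (q : nat) (K : {set 'I_q}) : 'M[R]_q :=
  diag_mx (\row_i (i \in K)%:R).

Lemma mul_indic_diag (R : realType) (q : nat) (K : {set 'I_q}) (c : 'rV[R]_q) :
  (forall i, i \notin K -> c 0 i = 0) <-> c *m indic_diag R K = c.
Proof.
split=> [csupp|<- i iK].
  apply/rowP => i; rewrite mul_mx_diag !mxE.
  by have [iK|iK] := boolP (i \in K); rewrite ?mulr1 // mulr0 csupp.
by rewrite mul_mx_diag !mxE (negPf iK) mulr0.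
Qed.

Lemma mask_rowsE (R : realType) (q n : nat) (K : {set 'I_q}) (r : 'I_q -> 'rV[R]_n) :
  \matrix_i (if i \in K then r i else 0) = indic_diag R K *m (\matrix_i r i).
Proof.
apply/matrixP => i j; rewrite mul_diag_mx !mxE.
by case: ifP => _; rewrite ?mul1r ?mul0r // mxE.
Qed.

Lemma rank_indic_diag_mul (R : realType) (q n : nat) (K : {set 'I_q}) (V : 'M[R]_(q, n)) :
  (forall c : 'rV[R]_q, (forall i, i \notin K -> c 0 i = 0) -> c *m V = 0 -> c = 0) ->
  \rank (indic_diag R K *m V) = \rank (indic_diag R K).
Proof.
move=> indep; apply/mxrank_injP; rewrite -submx0; apply/rV_subP => v.
rewrite sub_capmx => /andP[/submxP[w ->] /sub_kermxP wV].
rewrite (indep (w *m indic_diag R K)) ?sub0mx // => i iK.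
by rewrite mul_mx_diag !mxE (negPf iK) mulr0.
Qed.

(** Equal ranks force [D *m V] and [D] to have the same column space, so [D] factors through
    [D *m V]. Transposition turns this into an inclusion of row spaces. *)
Lemma mxrank_mul_right_inverse (F : fieldType) (q r n : nat) (D : 'M[F]_(q, r)) (V : 'M[F]_(r, n)) :
  \rank (D *m V) = \rank D -> exists H : 'M[F]_(n, r), D *m V *m H = D.
Proof.
move=> rDV; have le : ((D *m V)^T <= V^T *m D^T)%MS by rewrite trmx_mul.
have /submxP[X DE] : (D^T <= (D *m V)^T)%MS.
  rewrite -(geq_leqif (mxrank_leqif_sup _)) ?mxrank_tr ?rDV //.
  by rewrite trmx_mul submxMl.
by exists X^T; rewrite -[RHS]trmxK DE trmx_mul !trmxK.
Qed.

(** * Norm estimates and uniform coercivity *)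

Lemma cvg_fsum (R : realType) (T : Type) (F : set_system T) {FF : Filter F} (I : finType)
    (f : I -> T -> R) (l : I -> R) :
  (forall i, f i x @[x --> F] --> l i) -> \sum_i f i x @[x --> F] --> \sum_i l i.
Proof. by move=> fl; apply: cvg_big => //; exact: add_continuous. Qed.

(** A finite sum, hence continuous in the entries, which bounds the operator norm for the max norm
    on row vectors. *)
Definition mx_sum_norm (R : realType) (m n : nat) (A : 'M[R]_(m, n)) : R :=
  \sum_i \sum_j `|A i j|.

Lemma mx_sum_norm_ge0 (R : realType) (m n : nat) (A : 'M[R]_(m, n)) : 0 <= mx_sum_norm A.
Proof. by apply: sumr_ge0 => i _; apply: sumr_ge0. Qed.

Lemma ler_mx_entry_norm (R : realType) (m n : nat) (A : 'M[R]_(m, n)) i j : `|A i j| <= `|A|.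
Proof.
by rewrite /Num.norm/= mx_normrE (le_bigmax _ (fun ij => `|A ij.1 ij.2|) (i, j)).
Qed.

Lemma mx_norm_leP (R : realType) (m n : nat) (A : 'M[R]_(m, n)) (b : R) :
  0 <= b -> (forall i j, `|A i j| <= b) -> `|A| <= b.
Proof.
by move=> b0 Ab; rewrite /Num.norm/= mx_normrE; apply: bigmax_le => // ij _.
Qed.

Lemma norm_mulmx_le (R : realType) (m n : nat) (u : 'rV[R]_m) (A : 'M[R]_(m, n)) :
  `|u *m A| <= `|u| * mx_sum_norm A.
Proof.
apply: mx_norm_leP => [|i j]; first by rewrite mulr_ge0 ?mx_sum_norm_ge0.
rewrite ord1 mxE; apply: le_trans (ler_norm_sum _ _ _) _.
rewrite mulr_sumr; apply: ler_sum => k _; rewrite normrM.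
apply: ler_pM => //; first exact: ler_mx_entry_norm.
by rewrite (bigD1 j) //= lerDl sumr_ge0.
Qed.

(** Let [H] invert [V xb] on the right along the rows in [K]. Then [c] equals [c *m V x *m H] minus
    [c *m ((V x - V xb) *m H)]; near [xb] the second term is at most half of the norm of [c] and is
    absorbed, which gives twice the norm of [H] as constant. *)
Lemma near_coercive (R : realType) (p q n : nat) (V : 'rV[R]_p -> 'M[R]_(q, n))
    (xb : 'rV[R]_p) (K : {set 'I_q}) :
  (forall i j, {for xb, continuous (fun x => V x i j)}) ->
  \rank (indic_diag R K *m V xb) = \rank (indic_diag R K) ->
  exists2 M : R, 0 <= M & \forall x \near xb, forall c : 'rV[R]_q,
    (forall i, i \notin K -> c 0 i = 0) -> `|c| <= M * `|c *m V x|.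
Proof.
move=> Vcont /mxrank_mul_right_inverse[H HE].
exists (2 * mx_sum_norm H); first by rewrite mulr_ge0 ?mx_sum_norm_ge0.
have cv0 : mx_sum_norm ((V x - V xb) *m H) @[x --> xb] --> (0 : R).
  have -> : 0 = \sum_i \sum_j `|\sum_k (V xb i k - V xb i k) * H k j| :> R.
    rewrite big1 // => i _; rewrite big1 // => j _; rewrite big1 ?normr0 // => k _.
    by rewrite subrr mul0r.
  apply: (@cvg_fsum R _ (nbhs xb)) => i; apply: (@cvg_fsum R _ (nbhs xb)) => j; apply: cvg_norm.
  under eq_cvg do rewrite mxE.
  apply: (@cvg_fsum R _ (nbhs xb)) => k; under eq_cvg do rewrite !mxE.
  by apply: cvgM; [apply: cvgB; [exact: Vcont|exact: cvg_cst]|exact: cvg_cst].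
have small : \forall x \near xb, mx_sum_norm ((V x - V xb) *m H) < 2^-1.
  by apply: (cvgr_lt _ cv0); rewrite invr_gt0.
apply: filterS small => x small c /mul_indic_diag cK.
have cE : c = c *m V x *m H - c *m ((V x - V xb) *m H).
  rewrite mulmxBl mulmxBr mulmxA opprB addrCA subrr addr0.
  by rewrite -[in RHS]cK -!mulmxA [indic_diag _ _ *m _]mulmxA HE cK.
have := norm_mulmx_le (c *m V x) H.
have := norm_mulmx_le c ((V x - V xb) *m H).
have : `|c| <= `|c *m V x *m H| + `|c *m ((V x - V xb) *m H)|.
  by rewrite {1}cE ler_normB.
have : `|c| * mx_sum_norm ((V x - V xb) *m H) <= `|c| * 2^-1.
  by rewrite ler_wpM2l // ltW.
lra.
Qed.

(** This is the form in which constant rank enters the penalty argument: multipliers supported in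
    [A] may be replaced by ones controlled by the vector they represent. *)
Definition has_bounded_reductions (R : realType) (q n : nat) (V : 'M[R]_(q, n))
    (A : {set 'I_q}) (M : R) : Prop :=
  forall mu : 'rV[R]_q, (forall i, 0 <= mu 0 i) -> (forall i, i \notin A -> mu 0 i = 0) ->
  exists mu' : 'rV[R]_q, [/\ forall i, 0 <= mu' 0 i,
    forall i, mu 0 i = 0 -> mu' 0 i = 0, mu' *m V = mu *m V & `|mu'| <= M * `|mu *m V|].

(** The reduced support depends on [x] and [mu], but only finitely many sets [K] occur. If [K] is
    independent at [xb], coercivity supplies a constant; if it is dependent there, constant rank
    keeps it dependent nearby and the reduction cannot return it. The sum of the constants serves
    every [K]. *)
Lemma near_bounded_reductions (R : realType) (p q n : nat) (V : 'rV[R]_p -> 'M[R]_(q, n))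
    (xb : 'rV[R]_p) (A : {set 'I_q}) :
  (forall i j, {for xb, continuous (fun x => V x i j)}) ->
  (forall K : {set 'I_q}, K \subset A -> \forall x \near xb,
     \rank (indic_diag R K *m V x) = \rank (indic_diag R K *m V xb)) ->
  exists2 M : R, 0 <= M & \forall x \near xb, has_bounded_reductions (V x) A M.
Proof.
move=> Vcont crank.
have /choice[M Mprop] : forall K : {set 'I_q}, exists M : R, 0 <= M /\
    \forall x \near xb, K \subset A -> \rank (indic_diag R K *m V x) = \rank (indic_diag R K) ->
      forall c : 'rV[R]_q, (forall i, i \notin K -> c 0 i = 0) -> `|c| <= M * `|c *m V x|.
  move=> K; have [KA|_] := boolP (K \subset A); last first.
    by exists 0; split=> //; apply: (@filterE _ (nbhs xb)).
  have [rK|rK] := eqVneq (\rank (indic_diag R K *m V xb)) (\rank (indic_diag R K)).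
    have [M M0 MP] := near_coercive Vcont rK; exists M; split=> //.
    by apply: filterS MP => x xP _ _.
  exists 0; split=> //; apply: filterS (crank K KA) => x -> _ /eqP.
  by rewrite (negPf rK).
exists (\sum_K M K); first by apply: sumr_ge0 => K _; case: (Mprop K).
have nearall : \forall x \near xb, forall K : {set 'I_q}, K \subset A ->
    \rank (indic_diag R K *m V x) = \rank (indic_diag R K) ->
    forall c : 'rV[R]_q, (forall i, i \notin K -> c 0 i = 0) -> `|c| <= M K * `|c *m V x|.
  exact: (@filter_forall _ _ _ (nbhs xb) _ (fun K => (Mprop K).2)).
apply: filterS nearall => x xP mu mu_ge0 muA.
have [mu' [mu'_ge0 mu'supp mu'V mu'ind]] := conic_caratheodory (V x) mu_ge0.
exists mu'; split => //; rewrite -mu'V.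
pose K := [set i | mu' 0 i != 0]%SET.
have KA : K \subset A.
  apply/fintype.subsetP => i; rewrite inE; apply: contraR => /muA /mu'supp ->.
  by rewrite eqxx.
have mu'K i : i \notin K -> mu' 0 i = 0 by rewrite inE negbK => /eqP.
apply: le_trans (xP K KA _ _ mu'K) _.
  apply: rank_indic_diag_mul => c cK; apply: mu'ind => i mu'i; apply: cK.
  by rewrite inE mu'i eqxx.
rewrite ler_wpM2r // (bigD1 K) //= lerDl; apply: sumr_ge0 => K' _.
by case: (Mprop K').
Qed.

(** * The penalty argument *)

Lemma ultra_compact_cvg (T : Type) (U : set_system T) (X : topologicalType) (K : set X)
    (f : T -> X) :
  UltraFilter U -> compact K -> (\forall t \near U, K (f t)) ->
  exists2 p, K p & f t @[t --> U] --> p.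
Proof.
move=> UU Kc Kf; have UP := @ultra_proper _ _ UU.
have [p [Kp clp]] := Kc (f t @[t --> U]) _ Kf.
exists p => // B Bp.
have [//|UnB] := in_ultra_setVsetC (f @^-1` B) UU.
by have [y [nBy By]] := clp (~` B) B UnB Bp.
Qed.

Lemma ultra_bounded_cvg (R : realType) (T : Type) (U : set_system T) (f : T -> R) (M : R) :
  UltraFilter U -> (\forall t \near U, `|f t| <= M) -> exists l : R, f t @[t --> U] --> l.
Proof.
move=> UU fM; have UP := @ultra_proper _ _ UU.
have [|l _ fl] := @ultra_compact_cvg _ _ _ _ f UU (@segment_compact R (- M) M).
  by apply: filterS fM => t; rewrite ler_norml => /andP[fl fr]; rewrite /= in_itv/= fl.
by exists l.
Qed.

Lemma cvg_near_eq (R : realType) (T : Type) (F : set_system T) (f : T -> R) (a b : R) :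
  ProperFilter F -> f t @[t --> F] --> a -> (\forall t \near F, f t = b) -> a = b.
Proof.
move=> FF fa fb; apply: (norm_cvg_unique fa).
exact: cvg_near_cst.
Qed.

(** The first-order condition at a local minimum, with [s] the difference quotient: its one-sided
    limits have opposite signs and coincide. *)
Lemma cvg_dnbhs0_eq0 (R : realType) (s : R -> R) (l : R) :
  s t @[t --> (0 : R)^'] --> l -> (\forall t \near (0 : R)^', 0 <= t * s t) -> l = 0.
Proof.
move=> sl ts.
have tsl : \forall t \near (0 : R)^'-, 0 <= t * s t.
  by apply: (@filterS _ (nbhs (0 : R)) _ _ _ _ ts) => t tP t0; apply: tP; rewrite /= lt_eqF.
have tsr : \forall t \near (0 : R)^'+, 0 <= t * s t.
  by apply: (@filterS _ (nbhs (0 : R)) _ _ _ _ ts) => t tP t0; apply: tP; rewrite /= gt_eqF.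
apply/eqP; rewrite eq_le; apply/andP; split.
  apply: (cvgr_to_le (cvg_dnbhs_at_left sl)).
  by apply: filterS2 tsl (nbhs_left_lt 0) => t + t0; rewrite nmulr_rge0.
apply: (cvgr_to_ge (cvg_dnbhs_at_right sl)).
by apply: filterS2 tsr (nbhs_right_gt 0) => t + t0; rewrite pmulr_rge0.
Qed.

Lemma derivable_quotient_cvg (R : realType) (V : normedModType R) (h : V -> R) (x v : V) :
  derivable h x v -> t^-1 * (h (t *: v + x) - h x) @[t --> (0 : R)^'] --> 'D_v h x.
Proof. by []. Qed.

(* With m = max (g x, 0), this smooth expression dominates the variation of the
   penalty (see sqr_max_le), so the squared positive part is never differentiated. *)
Lemma surrogate_stationary (R : realType) (n q : nat) (g : 'rV[R]_n -> 'rV[R]_q)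
    (x u d : 'rV[R]_n) (r : R) (m : 'I_q -> R) (l : 'I_n) :
  differentiable g x ->
  (\forall y \near x, 0 <= \sum_k d 0 k * ((y : 'rV[R]_n) 0 k - x 0 k)
     + 2^-1 * (\sum_k (y 0 k - u 0 k) ^+ 2 - \sum_k (x 0 k - u 0 k) ^+ 2)
     + r * \sum_i (2 * m i * (g y 0 i - g x 0 i) + (g y 0 i - g x 0 i) ^+ 2)) ->
  d 0 l + (x 0 l - u 0 l) + r * \sum_i 2 * m i * grad (compf g i) x 0 l = 0.
Proof.
move=> gdiff locmin; pose e : 'rV[R]_n := delta_mx 0 l.
pose qu i (t : R) := t^-1 * (g (t *: e + x) 0 i - g x 0 i).
have qucvg i : qu i t @[t --> (0 : R)^'] --> grad (compf g i) x 0 l.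
  rewrite mxE; apply: derivable_quotient_cvg; apply: diff_derivable.
  rewrite /compf.
  by apply: (@differentiable_comp _ _ _ _ g (fun y : 'rV[R]_q => y 0 i : R));
    [|exact: differentiable_coord].
have idcvg : t @[t --> (0 : R)^'] --> (0 : R) by exact: cvg_within.
(* The increment of the surrogate along coordinate [l], divided by [t]; its limit at 0 is the left
   side of the claim. *)
pose s t := d 0 l + (x 0 l - u 0 l) + 2^-1 * t
  + r * \sum_i (2 * m i * qu i t + t * qu i t ^+ 2).
apply: (@cvg_dnbhs0_eq0 _ s).
  have -> : d 0 l + (x 0 l - u 0 l) + r * \sum_i 2 * m i * grad (compf g i) x 0 l
     = d 0 l + (x 0 l - u 0 l) + 2^-1 * 0 +
       r * \sum_i (2 * m i * grad (compf g i) x 0 l + 0 * (grad (compf g i) x 0 l) ^+ 2).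
    rewrite mulr0 addr0; congr (_ + _ * _); apply: eq_bigr => i _.
    by rewrite mul0r addr0.
  apply: cvgD; first by apply: cvgD; [exact: cvg_cst|apply: cvgM => //; exact: cvg_cst].
  apply: cvgM; first exact: cvg_cst.
  apply: (@cvg_fsum _ _ ((0 : R)^')) => i; apply: cvgD.
    by apply: cvgM => //; exact: cvg_cst.
  by apply: cvgM => //; apply: (@cvgM _ _ _ _ (qu i) (qu i)).
have xcvg : (t *: e + x) @[t --> (0 : R)] --> x.
  rewrite -[X in _ --> X]add0r -(scale0r e).
  by apply: cvgD; [apply: cvgZ; [exact: cvg_id|exact: cvg_cst]|exact: cvg_cst].
have near0 := xcvg _ locmin.
apply: (@filterS _ (nbhs (0 : R)) _ _ _ _ near0) => t /= tmin t0.
congr (0 <= _) : tmin => //.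
have ycoord k : (t *: e + x) 0 k = t * (k == l)%:R + x 0 k by rewrite !mxE eqxx.
have dE : \sum_k d 0 k * ((t *: e + x) 0 k - x 0 k) = t * d 0 l.
  rewrite (bigD1 l) //= big1 ?addr0 => [|k /negPf kl]; rewrite ycoord.
    by rewrite eqxx mulr1; ring.
  by rewrite kl mulr0; ring.
have uE : \sum_k ((t *: e + x) 0 k - u 0 k) ^+ 2 - \sum_k (x 0 k - u 0 k) ^+ 2
    = 2 * t * (x 0 l - u 0 l) + t ^+ 2.
  rewrite -sumrB (bigD1 l) //= big1 ?addr0 => [|k /negPf kl]; rewrite ycoord.
    by rewrite eqxx mulr1; ring.
  by rewrite kl mulr0; ring.
have gE i : g (t *: e + x) 0 i - g x 0 i = t * qu i t by rewrite /qu mulVKf.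
rewrite dE uE /s !mulrDr !mulr_sumr.
have -> : \sum_i r * (2 * m i * (g (t *: e + x) 0 i - g x 0 i) +
    (g (t *: e + x) 0 i - g x 0 i) ^+ 2) =
    \sum_i t * (r * (2 * m i * qu i t + t * qu i t ^+ 2)).
  by apply: eq_bigr => i _; rewrite gE; ring.
by congr (_ + _); field.
Qed.

Lemma cvg_coord (R : realType) (T : Type) (F : set_system T) {FF : Filter F} (m n : nat)
    (f : T -> 'M[R]_(m, n)) (A : 'M[R]_(m, n)) i j :
  f t @[t --> F] --> A -> f t i j @[t --> F] --> A i j.
Proof.
by move=> fA; apply: (cvg_comp f (fun B : 'M[R]_(m, n) => B i j) fA); exact: coord_continuous.
Qed.

(** The right side is the square of [Num.max t 0 + (s - t)], a number no smaller than [s]. The bound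
    is an equality at [s = t]. *)
Lemma sqr_max_le (R : realFieldType) (s t : R) :
  Num.max s 0 ^+ 2 <= Num.max t 0 ^+ 2 + 2 * Num.max t 0 * (s - t) + (s - t) ^+ 2.
Proof.
have -> : Num.max t 0 ^+ 2 + 2 * Num.max t 0 * (s - t) + (s - t) ^+ 2 =
  (Num.max t 0 + (s - t)) ^+ 2 by ring.
have [s0|s0] := leP s 0; first by rewrite expr0n sqr_ge0.
have [t0|t0] := leP t 0; last by have -> : t + (s - t) = s by ring.
by rewrite add0r lerXn2r ?nnegrE//; lra.
Qed.

(** A linear objective, a proximal term and a quadratic penalty. The proximal term makes [xs] the
    only minimiser over the feasible set when it minimises the linear part there. *)
Definition penalty (R : realType) (n q : nat) (g : 'rV[R]_n -> 'rV[R]_q)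
    (d xs : 'rV[R]_n) (r : R) (x : 'rV[R]_n) : R :=
  \sum_k d 0 k * (x 0 k - xs 0 k) + 2^-1 * \sum_k (x 0 k - xs 0 k) ^+ 2
  + r * \sum_i Num.max (g x 0 i) 0 ^+ 2.

Lemma penalty_cvg (R : realType) (n q : nat) (g : 'rV[R]_n -> 'rV[R]_q)
    (d xs : 'rV[R]_n) (r : R) (T : Type) (F : set_system T) (f : T -> 'rV[R]_n) (x : 'rV[R]_n) :
  Filter F -> {for x, continuous g} -> f t @[t --> F] --> x ->
  penalty g d xs r (f t) @[t --> F] --> penalty g d xs r x.
Proof.
move=> FF gcont fx.
have xcvg k : f t 0 k - xs 0 k @[t --> F] --> x 0 k - xs 0 k.
  by apply: cvgB; [exact: cvg_coord|exact: cvg_cst].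
apply: cvgD; first apply: cvgD.
- by apply: cvg_fsum => k; apply: cvgM; [exact: cvg_cst|exact: xcvg].
- apply: cvgM; first exact: cvg_cst.
  by apply: cvg_fsum => k; apply: (cvgM (xcvg k) (xcvg k)).
- apply: cvgM; first exact: cvg_cst.
  apply: cvg_fsum => i.
  have gcvg : Num.max (g (f t) 0 i) 0 @[t --> F] --> Num.max (g x 0 i) 0.
    have maxcont := @continuous_max _ _ (fun t : R => t) (fun=> 0) _
      (fun _ => id) (@cst_continuous _ _ 0 (g x 0 i)).
    apply: (cvg_comp (fun t => g (f t) 0 i) (fun t => Num.max t 0) _ maxcont).
    by apply: cvg_coord; apply: cvg_comp fx gcont.
  exact: (cvgM gcvg gcvg).
Qed.

(** By [sqr_max_le] the penalty has a smooth majorant touching it at [x], so [x] is also a local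
    minimiser of the majorant, to which the surrogate condition applies. *)
Lemma penalty_stationary (R : realType) (n q : nat) (g : 'rV[R]_n -> 'rV[R]_q)
    (d xs x : 'rV[R]_n) (r : R) (l : 'I_n) :
  0 <= r -> differentiable g x ->
  (\forall y \near x, penalty g d xs r x <= penalty g d xs r y) ->
  d 0 l + (x 0 l - xs 0 l)
    + \sum_i 2 * r * Num.max (g x 0 i) 0 * grad (compf g i) x 0 l = 0.
Proof.
move=> r0 gdiff locmin.
have H := @surrogate_stationary R n q g x xs d r (fun i => Num.max (g x 0 i) 0) l gdiff.
rewrite -[RHS]H; last first.
  apply: filterS locmin => y; rewrite /penalty => xy.
  have gle : r * \sum_i Num.max (g y 0 i) 0 ^+ 2 <= r * \sum_i Num.max (g x 0 i) 0 ^+ 2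
      + r * \sum_i (2 * Num.max (g x 0 i) 0 * (g y 0 i - g x 0 i) + (g y 0 i - g x 0 i) ^+ 2).
    rewrite -mulrDr ler_wpM2l // -big_split /=; apply: ler_sum => i _.
    by rewrite addrA; exact: sqr_max_le.
  have dE : \sum_k d 0 k * (y 0 k - x 0 k) =
      \sum_k d 0 k * (y 0 k - xs 0 k) - \sum_k d 0 k * (x 0 k - xs 0 k).
    by rewrite -sumrB; apply: eq_bigr => k _; ring.
  rewrite dE; lra.
by rewrite mulr_sumr; congr (_ + _); apply: eq_bigr => i _; ring.
Qed.

Lemma penalty_argmin (R : realType) (n q : nat) (g : 'rV[R]_n -> 'rV[R]_q)
    (d xs : 'rV[R]_n) (r : R) (K : set 'rV[R]_n) :
  (forall x, differentiable g x) -> compact K -> K xs ->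
  exists2 x, K x & forall y, K y -> penalty g d xs r x <= penalty g d xs r y.
Proof.
move=> gdiff Kc Kxs.
have [||x xK xmin] := @EVT_min_rV R n (penalty g d xs r) K _ Kc.
- by exists xs.
- apply: continuous_subspaceT => x; apply: (@penalty_cvg _ _ _ _ _ _ _ _ (nbhs x)).
  + exact: differentiable_continuous.
  + exact: cvg_id.
by exists x => [|y Ky]; [rewrite inE in xK|apply: xmin; rewrite inE].
Qed.

(** Minimisers of the penalty over the unit box around [xs], with weights [j.+1], tend to [xs] and
    so become interior to the box. Stationarity there yields multipliers that may be unbounded;
    reduction bounds them, and their limits are exact multipliers. The constant [M] is passed on
    unchanged, which later makes the bound uniform along the equilibria. *)
Lemma penalty_kkt (R : realType) (n q : nat) (g : 'rV[R]_n -> 'rV[R]_q)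
    (d xs : 'rV[R]_n) (A : {set 'I_q}) (M : R) :
  (forall x, differentiable g x) ->
  (forall i l, {for xs, continuous (fun x => grad (compf g i) x 0 l)}) ->
  (forall i, g xs 0 i <= 0) ->
  (forall y, (forall i, g y 0 i <= 0) -> 0 <= \sum_k d 0 k * (y 0 k - xs 0 k)) ->
  (forall i, i \notin A -> g xs 0 i < 0) ->
  (\forall x \near xs, has_bounded_reductions (\matrix_i grad (compf g i) x) A M) ->
  exists lam : 'rV[R]_q, [/\ forall i, 0 <= lam 0 i, forall i, lam 0 i * g xs 0 i = 0,
    d + \sum_i lam 0 i *: grad (compf g i) xs = 0 & forall i, `|lam 0 i| <= M * `|d|].
Proof.
move=> gdiff gradcont xsfeas vi Aact reduction.
pose K := [set v : 'rV[R]_n | forall k, `[xs 0 k - 1, xs 0 k + 1]%classic (v ord0 k)].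
have Kc : compact K.
  apply: (@rV_compact _ _ (fun k => `[xs 0 k - 1, xs 0 k + 1]%classic)) => k.
  exact: segment_compact.
have Kxs : K xs by move=> k; rewrite /= in_itv/= gerBl lerDl !ler01.
have /choice[x xP] : forall j : nat, exists x, K x /\
    forall y, K y -> penalty g d xs j.+1%:R x <= penalty g d xs j.+1%:R y.
  by move=> j; have [x xK xmin] := @penalty_argmin R n q g d xs j.+1%:R K gdiff Kc Kxs; exists x.
have xK j : K (x j) by case: (xP j).
have xle0 j : penalty g d xs j.+1%:R (x j) <= 0.
  apply: le_trans ((xP j).2 xs Kxs) _; rewrite /penalty.
  rewrite big1 => [|k _]; last by rewrite subrr mulr0.
  rewrite big1 => [|k _]; last by rewrite subrr expr0n.
  rewrite big1 => [|i _]; last by rewrite max_r // expr0n.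
  by rewrite !mulr0 !addr0.
have [U [UU leU]] := @ultraFilterLemma _ \oo _.
have UP := @ultra_proper _ _ UU.
have [xt _ xtcvg] : exists2 p, K p & x j @[j --> U] --> p.
  by apply: ultra_compact_cvg => //; exact: nearW.
have xtk k : x j 0 k @[j --> U] --> xt 0 k by exact: cvg_coord.
have gxcvg i : g (x j) 0 i @[j --> U] --> g xt 0 i.
  by apply: cvg_coord; exact: (cvg_comp x g xtcvg (differentiable_continuous (gdiff xt))).
have lincvg : \sum_k d 0 k * (x j 0 k - xs 0 k) @[j --> U] --> \sum_k d 0 k * (xt 0 k - xs 0 k).
  apply: cvg_fsum => k; apply: cvgM; first exact: cvg_cst.
  by apply: cvgB => //; exact: cvg_cst.
have sqcvg : \sum_k (x j 0 k - xs 0 k) ^+ 2 @[j --> U] --> \sum_k (xt 0 k - xs 0 k) ^+ 2.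
  apply: cvg_fsum => k.
  have xxk : x j 0 k - xs 0 k @[j --> U] --> xt 0 k - xs 0 k.
    by apply: cvgB => //; exact: cvg_cst.
  exact: (cvgM xxk xxk).
have linbnd j : - \sum_k `|d 0 k| <= \sum_k d 0 k * (x j 0 k - xs 0 k).
  rewrite -sumrN; apply: ler_sum => k _.
  have := xK j k; rewrite /= in_itv/= => /andP[xl xr].
  have xn : `|x j 0 k - xs 0 k| <= 1 by rewrite ler_norml; apply/andP; split; lra.
  have : `|d 0 k * (x j 0 k - xs 0 k)| <= `|d 0 k| by rewrite normrM ler_piMr.
  by rewrite ler_norml => /andP[].
have sqge0 j : 0 <= \sum_k (x j 0 k - xs 0 k) ^+ 2 by apply: sumr_ge0 => k _; exact: sqr_ge0.
have maxge0 j : 0 <= \sum_i Num.max (g (x j) 0 i) 0 ^+ 2.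
  by apply: sumr_ge0 => i _; exact: sqr_ge0.
(* The penalty vanishes at [xs] and the box bounds the linear term below, so the squared violations
   are at most a constant times [1 / (j + 1)]. *)
have xtfeas i : g xt 0 i <= 0.
  have mcvg : Num.max (g (x j) 0 i) 0 @[j --> U] --> Num.max (g xt 0 i) 0.
    have maxcont := @continuous_max _ _ (fun t : R => t) (fun=> 0) _
      (fun _ => id) (@cst_continuous _ _ 0 (g xt 0 i)).
    exact: (cvg_comp (fun j => g (x j) 0 i) (fun t => Num.max t 0) (gxcvg i) maxcont).
  have m2cvg : Num.max (g (x j) 0 i) 0 ^+ 2 @[j --> U] --> Num.max (g xt 0 i) 0 ^+ 2.
    exact: (cvgM mcvg mcvg).
  have hcvg : (\sum_k `|d 0 k|) * harmonic j @[j --> U] --> (\sum_k `|d 0 k|) * 0.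
    apply: cvgM; first exact: cvg_cst.
    by apply: cvg_trans (@cvg_harmonic R); exact: cvg_app.
  have : Num.max (g xt 0 i) 0 ^+ 2 <= 0.
    rewrite -[X in _ <= X](mulr0 (\sum_k `|d 0 k|)).
    apply: (ler_cvg_to m2cvg hcvg); apply: nearW => j /=.
    rewrite /harmonic ler_pdivlMr ?ltr0n // mulrC.
    have : j.+1%:R * \sum_i Num.max (g (x j) 0 i) 0 ^+ 2 <= \sum_k `|d 0 k|.
      have := xle0 j; rewrite /penalty; have := linbnd j; have := sqge0 j; lra.
    apply: le_trans; rewrite ler_wpM2l // (bigD1 i) //= lerDl.
    by apply: sumr_ge0 => k _; exact: sqr_ge0.
  rewrite exprn_even_le0 //= => /eqP maxeq.
  by rewrite -maxeq le_max lexx.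
(* In the limit the linear and proximal terms have sum at most 0, while [vi] makes the linear one
   nonnegative at the feasible point [xt]; hence the proximal term is zero. *)
have xtE : xt = xs.
  have : 2^-1 * \sum_k (xt 0 k - xs 0 k) ^+ 2 <= 0.
    have sumcvg : \sum_k d 0 k * (x j 0 k - xs 0 k) + 2^-1 * \sum_k (x j 0 k - xs 0 k) ^+ 2
        @[j --> U] --> \sum_k d 0 k * (xt 0 k - xs 0 k) + 2^-1 * \sum_k (xt 0 k - xs 0 k) ^+ 2.
      by apply: cvgD => //; apply: cvgM => //; exact: cvg_cst.
    have : \sum_k d 0 k * (xt 0 k - xs 0 k) + 2^-1 * \sum_k (xt 0 k - xs 0 k) ^+ 2 <= 0.
      apply: (cvgr_to_le sumcvg); apply: nearW => j; rewrite /=.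
      have := xle0 j; rewrite /penalty.
      have : 0 <= j.+1%:R * \sum_i Num.max (g (x j) 0 i) 0 ^+ 2 by rewrite mulr_ge0.
      lra.
    have := vi xt xtfeas; lra.
  rewrite pmulr_rle0 ?invr_gt0 // => sq0.
  apply/rowP => k; apply/eqP; rewrite -subr_eq0 -sqrf_eq0; apply/eqP.
  apply: (@psumr_eq0P _ _ xpredT (fun k => (xt 0 k - xs 0 k) ^+ 2)) => //.
    by move=> *; exact: sqr_ge0.
  apply/eqP; rewrite eq_le sq0 /=; apply: sumr_ge0 => *; exact: sqr_ge0.
move: xtE xtcvg xtk gxcvg {lincvg sqcvg xtfeas} => -> xcvg xkcvg gxcvg.
(* The coefficients of the constraint gradients in [penalty_stationary]; those of constraints
   inactive at [xs] eventually vanish. *)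
pose mu j : 'rV[R]_q := \row_i (2 * j.+1%:R * Num.max (g (x j) 0 i) 0).
have mu_ge0 j i : 0 <= mu j 0 i by rewrite mxE !mulr_ge0 // le_max lexx orbT.
have mu_supp : \forall j \near U, forall i, g xs 0 i < 0 -> mu j 0 i = 0.
  apply: filter_forall => i; have [gi|gi] := ltP (g xs 0 i) 0; last by apply: nearW.
  apply: filterS (cvgr_lt _ (gxcvg i) _ gi) => j gij _.
  by rewrite mxE max_r ?mulr0 // ltW.
have interior : \forall j \near U, \forall y \near x j, K y.
  have nK : \forall y \near xs, K y.
    apply: filterS (nbhsx_ballx xs 1 ltr01) => y [_ xy] k.
    have : `|xs 0 k - y 0 k| < 1 by exact: xy.
    rewrite ltr_norml /= in_itv/= => /andP[? ?]; apply/andP; split; lra.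
  exact: (xcvg _ (near_join nK)).
have statj : \forall j \near U, mu j *m (\matrix_i grad (compf g i) (x j)) = - (d + (x j - xs)).
  apply: filterS interior => j intj; apply/rowP => l.
  have locmin : \forall y \near x j, penalty g d xs j.+1%:R (x j) <= penalty g d xs j.+1%:R y.
    by apply: filterS intj; exact: (xP j).2.
  have := penalty_stationary l (ler0n _ _) (gdiff (x j)) locmin.
  move=> /eqP; rewrite addrC addr_eq0 => /eqP st.
  rewrite !mxE -st; apply: eq_bigr => i _.
  by rewrite !mxE.
(* Support and reduction properties hold only for almost all [j], so they stand as premises; where
   one fails, 0 is chosen. *)
have /choice[mu' mu'P] : forall j, exists mu' : 'rV[R]_q,
    (forall i, g xs 0 i < 0 -> mu j 0 i = 0) ->
    has_bounded_reductions (\matrix_i grad (compf g i) (x j)) A M ->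
    [/\ forall i, 0 <= mu' 0 i,
       forall i, mu j 0 i = 0 -> mu' 0 i = 0,
       mu' *m (\matrix_i grad (compf g i) (x j)) = mu j *m (\matrix_i grad (compf g i) (x j)) &
       `|mu'| <= M * `|mu j *m (\matrix_i grad (compf g i) (x j))|].
  move=> j; have [[H1 H2]|H] := pselect ((forall i, g xs 0 i < 0 -> mu j 0 i = 0) /\
    has_bounded_reductions (\matrix_i grad (compf g i) (x j)) A M).
    by have [i /Aact /H1 //|mu' mu'P] := H2 (mu j) (mu_ge0 j); exists mu'.
  by exists 0 => H1 H2; case: H.
have good := xcvg _ reduction; rewrite /= in good.
have dcvg : M * `|- (d + (x j - xs))| @[j --> U] --> M * `|d|.
  apply: cvgM; first exact: cvg_cst.
  under eq_cvg do rewrite normrN.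
  apply: cvg_norm; rewrite -[X in _ --> X]addr0 -(subrr xs).
  by apply: cvgD; [exact: cvg_cst|apply: cvgB => //; exact: cvg_cst].
have mu'bnd : \forall j \near U, `|mu' j| <= M * `|- (d + (x j - xs))|.
  by apply: filterS3 mu_supp good statj => j s gd <-; case: (mu'P j s gd).
have /choice[lam0 lam0cvg] : forall i, exists l : R, mu' j 0 i @[j --> U] --> l.
  move=> i; apply: (@ultra_bounded_cvg R _ U _ (M * `|d| + 1)) => //.
  have : \forall j \near U, M * `|- (d + (x j - xs))| < M * `|d| + 1.
    by apply: (cvgr_lt _ dcvg); rewrite ltrDl.
  apply: filterS2 mu'bnd => j b1 b2.
  by apply: le_trans (ler_mx_entry_norm _ _ _) _; apply: le_trans b1 (ltW b2).
exists (\row_i lam0 i); split.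
- move=> i; rewrite mxE; apply: (cvgr_to_ge (lam0cvg i)).
  by apply: filterS2 mu_supp good => j s gd; case: (mu'P j s gd).
- move=> i; rewrite mxE; have [gi|gi] := ltP (g xs 0 i) 0; last first.
    have -> : g xs 0 i = 0 by apply/eqP; rewrite eq_le xsfeas.
    by rewrite mulr0.
  rewrite (_ : lam0 i = 0) ?mul0r //; apply: (cvg_near_eq UP (lam0cvg i)).
  by apply: filterS2 mu_supp good => j s gd; case: (mu'P j s gd) => _ + _ _; apply; exact: s.
- apply/rowP => l; rewrite !mxE summxE.
  have limcvg : d 0 l + (x j 0 l - xs 0 l) + \sum_i mu' j 0 i * grad (compf g i) (x j) 0 l
      @[j --> U] --> d 0 l + (xs 0 l - xs 0 l) + \sum_i lam0 i * grad (compf g i) xs 0 l.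
    apply: cvgD; first by apply: cvgD; [exact: cvg_cst|apply: cvgB => //; exact: cvg_cst].
    apply: cvg_fsum => i; apply: cvgM; first exact: lam0cvg.
    exact: (cvg_comp x _ xcvg (gradcont i l)).
  rewrite subrr addr0 in limcvg.
  rewrite -[RHS](cvg_near_eq UP limcvg (b := 0)); last first.
    apply: filterS3 mu_supp good statj => j s gd st; have [_ _ muE _] := mu'P j s gd.
    have : (mu' j *m (\matrix_i grad (compf g i) (x j))) 0 l = - (d 0 l + (x j 0 l - xs 0 l)).
      by rewrite muE st !mxE.
    rewrite mxE => sE; rewrite -[in RHS](subrr (d 0 l + (x j 0 l - xs 0 l))) -sE.
    by congr (_ + _); apply: eq_bigr => i _; rewrite !mxE.
  by congr (_ + _); apply: eq_bigr => i _; rewrite !mxE.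
- move=> i; rewrite mxE; apply: (ler_cvg_to (cvg_norm (lam0cvg i)) dcvg).
  by apply: filterS mu'bnd => j; apply: le_trans; exact: ler_mx_entry_norm.
Qed.

(** * Slopes of the smoothing function *)

Definition convex_fun (R : realType) (f : R -> R) : Prop :=
  forall s t u : R, 0 <= u <= 1 -> f (u * s + (1 - u) * t) <= u * f s + (1 - u) * f t.

(** The chord inequality cleared of denominators, so that slope comparisons become polynomial. *)
Lemma convex_three_points (R : realType) (f : R -> R) (s t u : R) :
  convex_fun f -> s < t -> t < u -> (u - s) * f t <= (u - t) * f s + (t - s) * f u.
Proof.
move=> fconv st tu; have su : 0 < u - s by lra.
pose w := (u - t) / (u - s).
have w01 : 0 <= w <= 1.
  by apply/andP; split; [rewrite divr_ge0|rewrite ler_pdivrMr]; lra.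
have := fconv s u w w01.
have -> : w * s + (1 - w) * u = t by rewrite /w; field; lra.
rewrite -(ler_pM2l su) => /le_trans; apply.
by rewrite le_eqVlt; apply/orP; left; apply/eqP; rewrite /w; field; lra.
Qed.

(** Slopes of a convex function increase: for small [h > 0] the slope on [[t, t + h]] is at most
    that on [[t, v]], which is at most that on [[u, v]]. Then [h] tends to 0. *)
Lemma convex_derive_le_slope (R : realType) (f : R -> R) (t u v : R) :
  convex_fun f -> derivable f t 1 -> t < u -> u < v ->
  f^`() t <= (f v - f u) / (v - u).
Proof.
move=> fconv fder tu uv; rewrite derive1E.
have tv := lt_trans tu uv.
have := cvg_dnbhs_at_right (derivable_quotient_cvg fder).
move/cvgr_to_le; apply.
have hsmall : \forall h \near (0 : R)^'+, h < v - t by apply: nbhs_right_lt; rewrite subr_gt0.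
apply: filterS2 (nbhs_right_gt 0) hsmall => h h0 hvt.
rewrite [_ *: _]mulr1 ler_pdivlMr ?subr_gt0 // -mulrA ler_pdivrMl //.
have th : t < h + t by lra.
have hv : h + t < v by lra.
have := convex_three_points fconv th hv.
have := convex_three_points fconv tu uv.
have vt : 0 < v - t by lra.
rewrite -(ler_pM2l vt) => H1 H2.
have uvpos : 0 < v - u by lra.
have : (v - t) * (v - u) * (f (h + t) - f t) <= (v - u) * (h * (f v - f t)).
  have := ler_wpM2l (ltW uvpos) H2; nra.
have : (v - u) * (f v - f t) <= (v - t) * (f v - f u).
  by move: H1; rewrite ler_pM2l //; nra.
move=> H3 H4.
rewrite -(ler_pM2l vt).
have := ler_wpM2l (ltW h0) H3; nra.
Qed.

Lemma convex_derive_ge_slope (R : realType) (f : R -> R) (t u v : R) :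
  convex_fun f -> derivable f t 1 -> u < v -> v < t ->
  (f v - f u) / (v - u) <= f^`() t.
Proof.
move=> fconv fder uv vt; rewrite derive1E.
have := cvg_dnbhs_at_left (derivable_quotient_cvg fder).
move/cvgr_to_ge; apply.
have hsmall : \forall h \near (0 : R)^'-, u - t < h by apply: nbhs_left_gt; lra.
apply: filterS2 (nbhs_left_lt 0) hsmall => h h0 hvt.
rewrite [_ *: _]mulr1 ler_pdivrMr ?subr_gt0 // -mulrA ler_ndivlMl //.
have th : u < h + t by lra.
have hv : h + t < t by lra.
have H2 := convex_three_points fconv th hv.
have H1 := convex_three_points fconv uv vt.
have ut : 0 < t - u by lra.
have uvpos : 0 < v - u by lra.
have H3 : (t - u) * (f (h + t) - f t) <= h * (f t - f u) by nra.
have H4 : (t - u) * (f v - f u) <= (v - u) * (f t - f u) by nra.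
rewrite -(ler_pM2l ut).
have hn : 0 <= - h by lra.
have := ler_wpM2l hn H4; have := ler_wpM2l (ltW uvpos) H3; nra.
Qed.

(** Pointwise convergence controls slopes of fixed chords; derivatives are afterwards trapped
    between such chords. *)
Lemma smoothing_slope_cvg (R : realType) (phi : R -> R -> R) (T : Type) (F : set_system T)
    (eps : T -> R) (u v : R) :
  Filter F -> (forall t, phi e t @[e --> 0^'+] --> `|t|) ->
  (forall k, 0 < eps k) -> eps k @[k --> F] --> (0 : R) ->
  (phi (eps k) v - phi (eps k) u) / (v - u) @[k --> F] --> (`|v| - `|u|) / (v - u).
Proof.
move=> FF phicvg eps_gt0 eps0.
have eps0r : eps k @[k --> F] --> (0 : R)^'+.
  move=> A A0.
  have H : \forall k \near F, 0 < eps k -> A (eps k) := eps0 (fun x => 0 < x -> A x) A0.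
  by apply: (@filterS _ F _ _ _ _ H) => k; exact.
have phik t : phi (eps k) t @[k --> F] --> `|t|.
  exact: (cvg_comp eps (fun e => phi e t) eps0r (phicvg t)).
by apply: cvgM; [apply: cvgB; exact: phik|exact: cvg_cst].
Qed.

(** The strict inequality [t < u] leaves room for the moving point: eventually [tk k < u], and the
    fixed chord over [[u, v]] bounds the derivative there. *)
Lemma smoothing_derive_near_le (R : realType) (phi : R -> R -> R) (T : Type) (F : set_system T)
    (eps tk : T -> R) (t u v b : R) :
  Filter F -> (forall e, 0 < e -> convex_fun (phi e)) ->
  (forall e, 0 < e -> forall s, derivable (phi e) s 1) ->
  (forall s, phi e s @[e --> 0^'+] --> `|s|) ->
  (forall k, 0 < eps k) -> eps k @[k --> F] --> (0 : R) -> tk k @[k --> F] --> t ->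
  t < u -> u < v -> (`|v| - `|u|) / (v - u) < b ->
  \forall k \near F, (phi (eps k))^`() (tk k) <= b.
Proof.
move=> FF conv der phicvg eps_gt0 eps0 tcvg tu uv ub.
have slope := @smoothing_slope_cvg R phi T F eps u v FF phicvg eps_gt0 eps0.
apply: filterS2 (cvgr_lt _ tcvg _ tu) (cvgr_lt _ slope _ ub) => k tku /ltW; apply: le_trans.
by apply: convex_derive_le_slope => //; [exact: conv|exact: der].
Qed.

Lemma smoothing_derive_near_ge (R : realType) (phi : R -> R -> R) (T : Type) (F : set_system T)
    (eps tk : T -> R) (t u v b : R) :
  Filter F -> (forall e, 0 < e -> convex_fun (phi e)) ->
  (forall e, 0 < e -> forall s, derivable (phi e) s 1) ->
  (forall s, phi e s @[e --> 0^'+] --> `|s|) ->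
  (forall k, 0 < eps k) -> eps k @[k --> F] --> (0 : R) -> tk k @[k --> F] --> t ->
  u < v -> v < t -> b < (`|v| - `|u|) / (v - u) ->
  \forall k \near F, b <= (phi (eps k))^`() (tk k).
Proof.
move=> FF conv der phicvg eps_gt0 eps0 tcvg uv vt ub.
have slope := @smoothing_slope_cvg R phi T F eps u v FF phicvg eps_gt0 eps0.
apply: filterS2 (cvgr_gt _ tcvg _ vt) (cvgr_gt _ slope _ ub) => k tkv /ltW /le_trans; apply.
by apply: convex_derive_ge_slope => //; [exact: conv|exact: der].
Qed.

Lemma smoothing_derive_bounded (R : realType) (phi : R -> R -> R) (T : Type) (F : set_system T)
    (eps tk : T -> R) (t b : R) :
  Filter F -> (forall e, 0 < e -> convex_fun (phi e)) ->
  (forall e, 0 < e -> forall s, derivable (phi e) s 1) ->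
  (forall s, phi e s @[e --> 0^'+] --> `|s|) ->
  (forall k, 0 < eps k) -> eps k @[k --> F] --> (0 : R) -> tk k @[k --> F] --> t ->
  1 < b -> \forall k \near F, `|(phi (eps k))^`() (tk k)| <= b.
Proof.
move=> FF conv der phicvg eps_gt0 eps0 tcvg b1.
have tn : - `|t| <= t <= `|t| by rewrite -ler_norml.
have t0 := normr_ge0 t.
have up : \forall k \near F, (phi (eps k))^`() (tk k) <= b.
  (* This chord lies to the right of [t] and of 0, where the absolute value has slope 1; the lower
     bound uses its mirror image. *)
  apply: (@smoothing_derive_near_le _ _ _ _ _ _ t (`|t| + 1) (`|t| + 2)) => //; try lra.
  rewrite (@gtr0_norm _ (`|t| + 2)) ?(@gtr0_norm _ (`|t| + 1)); try lra.
  by rewrite (_ : _ / _ = 1) //; field; lra.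
have lo : \forall k \near F, - b <= (phi (eps k))^`() (tk k).
  apply: (@smoothing_derive_near_ge _ _ _ _ _ _ t (- `|t| - 2) (- `|t| - 1)) => //; try lra.
  rewrite (@ltr0_norm _ (- `|t| - 1)) ?(@ltr0_norm _ (- `|t| - 2)); try lra.
  by rewrite (_ : _ / _ = -1) ?ltrN2 //; field; lra.
by apply: filterS2 up lo => k; rewrite ler_norml => -> ->.
Qed.

Lemma smoothing_derive_cvg (R : realType) (phi : R -> R -> R) (T : Type) (F : set_system T)
    (eps tk : T -> R) (t psi : R) :
  ProperFilter F -> (forall e, 0 < e -> convex_fun (phi e)) ->
  (forall e, 0 < e -> forall s, derivable (phi e) s 1) ->
  (forall s, phi e s @[e --> 0^'+] --> `|s|) ->
  (forall k, 0 < eps k) -> eps k @[k --> F] --> (0 : R) -> tk k @[k --> F] --> t ->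
  (phi (eps k))^`() (tk k) @[k --> F] --> psi ->
  [/\ `|psi| <= 1, 0 < t -> psi = 1 & t < 0 -> psi = -1].
Proof.
move=> FF conv der phicvg eps_gt0 eps0 tcvg psicvg.
have psi1 : `|psi| <= 1.
  apply/ler_addgt0Pr => e e0.
  apply: (cvgr_to_le (cvg_norm psicvg)).
  by apply: (@smoothing_derive_bounded _ _ _ _ _ _ t) => //; rewrite ltrDl.
have [psil psir] : -1 <= psi /\ psi <= 1 by apply/andP; rewrite -ler_norml.
split=> [|t0|t0]; first exact: psi1.
  apply/eqP; rewrite eq_le psir /=.
  apply/ler_addgt0Pr => e e0; rewrite -lerBlDr.
  apply: (cvgr_to_ge psicvg).
  (* A chord strictly between 0 and [t] is left of [t] but still has slope 1 in the limit; the
     negative case is symmetric. *)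
  apply: (@smoothing_derive_near_ge _ _ _ _ _ _ t (t / 3) (t / 2)) => //; try lra.
  rewrite !gtr0_norm; try lra.
  by rewrite (_ : _ / (_ - _) = 1); [lra|field; lra].
apply/eqP; rewrite eq_le psil andbT.
apply/ler_addgt0Pr => e e0.
apply: (cvgr_to_le psicvg).
apply: (@smoothing_derive_near_le _ _ _ _ _ _ t (t / 2) (t / 3)) => //; try lra.
rewrite !ltr0_norm; try lra.
by rewrite (_ : _ / (_ - _) = -1); [lra|field; lra].
Qed.

(** * Equilibria and the gradients of the MPCC data *)

Lemma addmxE (R : nmodType) (m n : nat) (A B : 'M[R]_(m, n)) i j : (A + B) i j = A i j + B i j.
Proof. by rewrite mxE. Qed.

Lemma scalemxE (R : pzSemiRingType) (m n : nat) (t : R) (A : 'M[R]_(m, n)) i j :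
  (t *: A) i j = t * A i j.
Proof. by rewrite mxE. Qed.

Lemma trmxE (R : Type) (m n : nat) (A : 'M[R]_(m, n)) i j : A^T i j = A j i.
Proof. by rewrite mxE. Qed.

Lemma quad_form_line (R : realType) (n : nat) (Q : 'M[R]_n) (v x : 'rV[R]_n) (t : R) :
  Q^T = Q ->
  ((t *: v + x) *m Q *m (t *: v + x)^T) 0 0 =
  (x *m Q *m x^T) 0 0 + 2 * t * (v *m Q *m x^T) 0 0 + t ^+ 2 * (v *m Q *m v^T) 0 0.
Proof.
move=> Qsym.
have cross : (x *m Q *m v^T) 0 0 = (v *m Q *m x^T) 0 0.
  have -> : x *m Q *m v^T = (v *m Q *m x^T)^T by rewrite !trmx_mul trmxK Qsym mulmxA.
  by rewrite mxE.
rewrite linearD linearZ /= !mulmxDl !mulmxDr -!scalemxAl -!scalemxAr.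
by rewrite !(addmxE, scalemxE) cross; ring.
Qed.

Lemma lin_form_line (R : realType) (n : nat) (c v x : 'rV[R]_n) (t : R) :
  (c *m (t *: v + x)^T) 0 0 = (c *m x^T) 0 0 + t * (c *m v^T) 0 0.
Proof. by rewrite linearD linearZ /= mulmxDr -scalemxAr addmxE scalemxE addrC. Qed.

Section BlockProfiles.
Variables (R : realType) (N : nat) (nn : 'I_N -> nat) (m : nat).
Implicit Types (x : @profile R N nn) (nu : 'I_N).

Lemma upd_same x nu (y : 'rV[R]_(nn nu)) : upd x y nu = y.
Proof. exact: dfwithin. Qed.

Lemma BTx_upd (B : forall nu, 'M[R]_(nn nu, m)) x nu (y : 'rV[R]_(nn nu)) :
  BTx B (upd x y) = BTx B x + (y - x nu) *m B nu.
Proof.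
rewrite /BTx (bigD1 nu) //= [in RHS](bigD1 nu) //= upd_same mulmxBl.
rewrite (eq_bigr (fun mu => x mu *m B mu)) => [|mu munu]; last first.
  by rewrite /upd dfwithout // eq_sym.
by rewrite addrAC [X in _ = X + _]addrC addrNK.
Qed.

Lemma QyBTx_upd (Qy : 'M[R]_m) (B : forall nu, 'M[R]_(nn nu, m)) x nu (y : 'rV[R]_(nn nu)) :
  QyBTx Qy B (upd x y) = QyBTx Qy B x + (y - x nu) *m (B nu *m (invmx Qy)^T).
Proof. by rewrite /QyBTx BTx_upd mulmxDl mulmxA. Qed.

(** The gradient of the objective of player [nu] in the own variable, with the slopes of the
    smoothing function replaced by parameters [psi]. One formula thus covers the equilibria and the
    limit, where the slopes are only limits. *)
Definition nep_grad (Q : forall nu, 'M[R]_(nn nu)) (c : forall nu, 'rV[R]_(nn nu))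
    (a : 'rV[R]_m) (Qy : 'M[R]_m) (B L : forall nu, 'M[R]_(nn nu, m)) nu
    (xnu : 'rV[R]_(nn nu)) (psi : 'I_m -> R) : 'rV[R]_(nn nu) :=
  (Q nu *m xnu^T)^T + c nu + 2^-1 *: ((L nu + B nu *m (invmx Qy)^T) *m a^T)^T
  + 2^-1 *: \sum_(i < m) (a 0 i * psi i) *: (col i (L nu - B nu *m (invmx Qy)^T))^T.

Lemma nep_grad_dot (Q : forall nu, 'M[R]_(nn nu)) (c : forall nu, 'rV[R]_(nn nu))
    (a : 'rV[R]_m) (Qy : 'M[R]_m) (B L : forall nu, 'M[R]_(nn nu, m)) nu
    (xnu v : 'rV[R]_(nn nu)) (psi : 'I_m -> R) :
  (nep_grad Q c a Qy B L xnu psi *m v^T) 0 0 =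
  (v *m Q nu *m xnu^T) 0 0 + (c nu *m v^T) 0 0
  + 2^-1 * \sum_i a 0 i * ((v *m (L nu + B nu *m (invmx Qy)^T)) 0 i +
                           (v *m (L nu - B nu *m (invmx Qy)^T)) 0 i * psi i).
Proof.
rewrite /nep_grad.
move: (L nu + _) (L nu - _) => Mp Mm.
rewrite !mulmxDl -!scalemxAl mulmx_suml.
have -> : (Q nu *m xnu^T)^T *m v^T = (v *m Q nu *m xnu^T)^T.
  by rewrite -mulmxA [RHS]trmx_mul.
have -> : (Mp *m a^T)^T *m v^T = (v *m Mp *m a^T)^T by rewrite -mulmxA [RHS]trmx_mul.
rewrite !(addmxE, scalemxE) !trmxE summxE.
have -> : (v *m Mp *m a^T) 0 0 = \sum_i a 0 i * (v *m Mp) 0 i.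
  by rewrite mxE; apply: eq_bigr => i _; rewrite [a^T _ _]mxE mulrC.
rewrite -addrA -mulrDr -big_split /=; congr (_ + 2^-1 * _); apply: eq_bigr => i _.
rewrite -scalemxAl scalemxE mulrDr -mulrA [psi i * _]mulrC.
have -> : ((col i Mm)^T *m v^T) 0 0 = (v *m Mm) 0 i; last by [].
by rewrite !mxE; apply: eq_bigr => k _; rewrite !mxE mulrC.
Qed.

(** Convexity of [g nu] keeps the segment from [x nu] to [y] feasible, so the objective does not
    decrease along it and its one-sided derivative at [x nu] is nonnegative. *)
Lemma NE_variational_inequality (Q : forall nu, 'M[R]_(nn nu)) (c : forall nu, 'rV[R]_(nn nu))
    (mg : 'I_N -> nat) (g : forall nu, 'rV[R]_(nn nu) -> 'rV[R]_(mg nu))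
    (a : 'rV[R]_m) (Qy : 'M[R]_m) (B L : forall nu, 'M[R]_(nn nu, m))
    (phit : R -> R -> R) (eps : R) x nu (y : 'rV[R]_(nn nu)) :
  (Q nu)^T = Q nu ->
  (forall i (u v : 'rV[R]_(nn nu)) (t : R), 0 <= t <= 1 ->
     g nu (t *: u + (1 - t) *: v) 0 i <= t * g nu u 0 i + (1 - t) * g nu v 0 i) ->
  (forall t, derivable (phit eps) t 1) ->
  is_NE Q c g a Qy B L phit eps x -> (forall i, g nu y 0 i <= 0) ->
  0 <= \sum_k nep_grad Q c a Qy B L (x nu)
         (fun i => derive1 (phit eps) ((BTx L x - QyBTx Qy B x) 0 i)) 0 k * (y 0 k - x nu 0 k).
Proof.
move=> Qsym gconv phider NE yfeas; have [xfeas xmin] := NE nu.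
pose v := y - x nu.
pose Mp := L nu + B nu *m (invmx Qy)^T.
pose Mm := L nu - B nu *m (invmx Qy)^T.
pose s i := (BTx L x - QyBTx Qy B x) 0 i.
pose r i := (v *m Mm) 0 i.
pose dphi i t := t^-1 * (phit eps (t * r i + s i) - phit eps (s i)).
have dphicvg i : dphi i t @[t --> (0 : R)^'] --> r i * derive1 (phit eps) (s i).
  have pdiff : differentiable (phit eps) (s i) by apply/derivable1_diffP; exact: phider.
  have -> : r i * derive1 (phit eps) (s i) = 'D_(r i) (phit eps) (s i).
    have rE : r i = r i *: (1 : R) by rewrite /GRing.scale/= mulr1.
    by rewrite derive1E !deriveE // [in RHS]rE linearZ.
  by apply: derivable_quotient_cvg; apply: diff_derivable.
(* The increment of [theta] along [v] divided by [t], expanded so that only [dphi] needs a limit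
   theorem. *)
pose q t := (v *m Q nu *m (x nu)^T) 0 0 + 2^-1 * (v *m Q nu *m v^T) 0 0 * t + (c nu *m v^T) 0 0
  + 2^-1 * \sum_i a 0 i * ((v *m Mp) 0 i + dphi i t).
have idcvg : t @[t --> (0 : R)^'] --> (0 : R) by exact: cvg_within.
have qcvg : q t @[t --> (0 : R)^'] -->
    (v *m Q nu *m (x nu)^T) 0 0 + 2^-1 * (v *m Q nu *m v^T) 0 0 * 0 + (c nu *m v^T) 0 0
    + 2^-1 * \sum_i a 0 i * ((v *m Mp) 0 i + r i * derive1 (phit eps) (s i)).
  apply: cvgD.
    apply: cvgD; last exact: cvg_cst.
    by apply: cvgD; [exact: cvg_cst|apply: cvgM => //; exact: cvg_cst].
  apply: cvgM; first exact: cvg_cst.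
  apply: (@cvg_fsum _ _ ((0 : R)^')) => i; apply: cvgM; first exact: cvg_cst.
  by apply: cvgD => //; exact: cvg_cst.
have qE t : theta Q c a Qy B L phit eps nu (upd x (t *: v + x nu))
    - theta Q c a Qy B L phit eps nu x = t * q t.
  rewrite /theta upd_same BTx_upd QyBTx_upd addrK quad_form_line // lin_form_line.
  have sumE : \sum_i a 0 i * ((BTx L x + t *: v *m L nu +
        (QyBTx Qy B x + t *: v *m (B nu *m (invmx Qy)^T))) 0 i +
      phit eps ((BTx L x + t *: v *m L nu -
        (QyBTx Qy B x + t *: v *m (B nu *m (invmx Qy)^T))) 0 i))
    = \sum_i a 0 i * ((BTx L x + QyBTx Qy B x) 0 i + phit eps ((BTx L x - QyBTx Qy B x) 0 i))
    + t * \sum_i a 0 i * ((v *m Mp) 0 i + dphi i t).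
    rewrite mulr_sumr -big_split /=; apply: eq_bigr => i _.
    have -> : BTx L x + t *: v *m L nu + (QyBTx Qy B x + t *: v *m (B nu *m (invmx Qy)^T)) =
        BTx L x + QyBTx Qy B x + t *: (v *m Mp).
      by rewrite addrACA -mulmxDr -scalemxAl.
    have -> : BTx L x + t *: v *m L nu - (QyBTx Qy B x + t *: v *m (B nu *m (invmx Qy)^T)) =
        t *: (v *m Mm) + (BTx L x - QyBTx Qy B x).
      by rewrite opprD addrACA -mulmxBr -scalemxAl addrC.
    rewrite (addmxE _ (t *: (v *m Mp))) (addmxE (t *: (v *m Mm))) !scalemxE -/(r i) -/(s i).
    have -> : phit eps (t * r i + s i) = phit eps (s i) + t * dphi i t.
      have [->|t0] := eqVneq t 0; first by rewrite !mul0r add0r addr0.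
      by rewrite /dphi mulVKf // [RHS]addrC subrK.
    by ring.
  by rewrite sumE /q; field.
have q_ge0 : \forall t \near (0 : R)^'+, 0 <= q t.
  have t1 : \forall t \near (0 : R)^'+, t < 1 by apply: nbhs_right_lt.
  apply: filterS2 (nbhs_right_gt 0) t1 => t t0 t1.
  rewrite -(pmulr_rge0 _ t0) -qE subr_ge0; apply: xmin => i.
  have -> : t *: v + x nu = t *: y + (1 - t) *: x nu.
    by rewrite scalerBr scalerBl scale1r -addrA [- _ + _]addrC.
  have t01 : 0 <= t <= 1 by rewrite !ltW.
  apply: le_trans (gconv i y (x nu) t t01) _.
  by rewrite -oppr_ge0 opprD; have := yfeas i; have := xfeas i; nra.
apply: le_trans (cvgr_to_ge (cvg_dnbhs_at_right qcvg) q_ge0) _.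
rewrite le_eqVlt; apply/orP; left; apply/eqP; rewrite mulr0 addr0.
set d := nep_grad _ _ _ _ _ _ _ _.
have -> : \sum_k d 0 k * (y 0 k - x nu 0 k) = (d *m v^T) 0 0.
  by rewrite mxE; apply: eq_bigr => k _; rewrite !mxE.
by rewrite /d nep_grad_dot.
Qed.

End BlockProfiles.

(** * Gradients of the MPCC functions and the rank condition in the player variable *)

Lemma grad_quadratic (R : realType) (p : nat) (f : 'rV[R]_p -> R) (z w : 'rV[R]_p)
    (b : 'rV[R]_p -> R) :
  (forall v t, f (t *: v + z) = f z + t * (v *m w^T) 0 0 + t ^+ 2 * b v) -> grad f z = w.
Proof.
move=> fE; apply/rowP => j; rewrite mxE; set v := delta_mx 0 j.
have wj : (v *m w^T) 0 0 = w 0 j by rewrite -rowE !mxE.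
have fcvg : t^-1 * (f (t *: v + z) - f z) @[t --> (0 : R)^'] --> w 0 j.
  have lcvg : w 0 j + t * b v @[t --> (0 : R)^'] --> w 0 j + 0 * b v.
    apply: cvgD; first exact: cvg_cst.
    by apply: cvgM; [exact: cvg_within|exact: cvg_cst].
  rewrite mul0r addr0 in lcvg.
  have quotE : \forall t \near (0 : R)^', w 0 j + t * b v = t^-1 * (f (t *: v + z) - f z).
    apply: filterS (nbhs_dnbhs_neq (0 : R)) => t t0.
    by rewrite fE wj; field; exact: t0.
  exact: cvg_trans (near_eq_cvg quotE) lcvg.
exact: (cvg_lim (@Rhausdorff R) fcvg).
Qed.

Lemma mul_row_mx_tr (R : comPzRingType) (n m : nat) (v w : 'rV[R]_(n + m)) :
  (v *m w^T) 0 0 = (lsubmx v *m (lsubmx w)^T) 0 0 + (rsubmx v *m (rsubmx w)^T) 0 0.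
Proof.
rewrite -{1}[v]hsubmxK -{1}[w]hsubmxK tr_row_mx mul_row_col.
exact: addmxE.
Qed.

(** Difference quotients depend on the direction only through its left block, which is zero for the
    last [m] basis vectors. *)
Lemma grad_lsubmx (R : realType) (n m : nat) (h : 'rV[R]_n -> R) (z : 'rV[R]_(n + m)) :
  grad (fun z => h (lsubmx z)) z = row_mx (grad h (lsubmx z)) 0.
Proof.
have DE v : 'D_v (fun z => h (lsubmx z)) z = 'D_(lsubmx v) h (lsubmx z).
  have E : (fun t : R => t^-1 *: (h (lsubmx (t *: v + z)) - h (lsubmx z))) =
      (fun t : R => t^-1 *: (h (t *: lsubmx v + lsubmx z) - h (lsubmx z))).
    by apply/funext => t; rewrite [lsubmx (_ + _)]linearD /= [lsubmx (_ *: _)]linearZ.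
  exact: (congr1 (fun F : R -> R => lim (F t @[t --> (0 : R)^'])) E).
apply/rowP => j; rewrite !mxE; case: splitP => k jk; rewrite DE !mxE.
  congr ('D_ _ h _); apply/rowP => l; rewrite !mxE; congr ((_ && _)%:R).
  by rewrite -!val_eqE /= jk.
have -> : lsubmx (delta_mx 0 j) = 0 :> 'rV[R]_n.
  apply/rowP => l; rewrite !mxE eqxx -val_eqE /= jk.
  by rewrite ltn_eqF // ltn_addr.
by rewrite derive0.
Qed.

(** Slicing a neighbourhood at fixed [y] carries the rank condition from pairs to the player
    variable alone. *)
Lemma nbhs_row_mx (R : realType) (n m : nat) (x : 'rV[R]_n) (y : 'rV[R]_m)
    (P : set 'rV[R]_(n + m)) :
  (\forall w \near row_mx x y, P w) -> \forall x' \near x, P (row_mx x' y).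
Proof.
move=> /nbhs_ballP[e e0 eP]; apply/nbhs_ballP; exists e => // x' [_ xx'].
apply: eP; split=> // i j; rewrite !mxE; case: splitP => k _; first exact: xx'.
exact: ballxx.
Qed.

Section MPCCGradients.
Variables (R : realType) (N : nat) (nn : 'I_N -> nat) (m : nat).
Implicit Types (nu : 'I_N).

Lemma grad_mpcc_g (mg : 'I_N -> nat) (g : forall nu, 'rV[R]_(nn nu) -> 'rV[R]_(mg nu)) nu
    (i : 'I_(mg nu)) (z : 'rV[R]_(nn nu + m)) :
  grad (compf (mpcc_g g nu) i) z = row_mx (grad (compf (g nu) i) (lsubmx z)) 0.
Proof. exact: (grad_lsubmx (compf (g nu) i)). Qed.

Lemma grad_mpcc_f (Q : forall nu, 'M[R]_(nn nu)) (c : forall nu, 'rV[R]_(nn nu))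
    (a : 'rV[R]_m) nu (z : 'rV[R]_(nn nu + m)) :
  (Q nu)^T = Q nu ->
  grad (mpcc_f Q c a nu) z = row_mx ((Q nu *m (lsubmx z)^T)^T + c nu) a.
Proof.
move=> Qsym.
apply: (@grad_quadratic _ _ _ _ _ (fun v => 2^-1 * (lsubmx v *m Q nu *m (lsubmx v)^T) 0 0)) => v t.
rewrite /mpcc_f mul_row_mx_tr row_mxKl row_mxKr.
have -> : lsubmx (t *: v + z) = t *: lsubmx v + lsubmx z by apply/rowP => k; rewrite !mxE.
have -> : rsubmx (t *: v + z) = t *: rsubmx v + rsubmx z by apply/rowP => k; rewrite !mxE.
rewrite quad_form_line // !lin_form_line.
have -> : (lsubmx v *m ((Q nu *m (lsubmx z)^T)^T + c nu)^T) 0 0 =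
    (lsubmx v *m Q nu *m (lsubmx z)^T) 0 0 + (c nu *m (lsubmx v)^T) 0 0.
  rewrite linearD /= trmxK mulmxDr addmxE mulmxA; congr (_ + _).
  by rewrite -[RHS]trmxE trmx_mul trmxK.
have -> : (rsubmx v *m a^T) 0 0 = (a *m (rsubmx v)^T) 0 0.
  by rewrite -[RHS]trmxE trmx_mul trmxK.
by field.
Qed.

(** Both complementarity maps have this affine form, so the expansion along a line has no
    second-order term. *)
Lemma grad_affine_constraint (W : forall nu, 'M[R]_(nn nu, m)) (F : @profile R N nn -> 'rV[R]_m)
    (xb : @profile R N nn) nu (i : 'I_m) (z : 'rV[R]_(nn nu + m)) :
  (forall y, F (upd xb y) = F xb + (y - xb nu) *m W nu) ->
  grad (compf (fun z : 'rV[R]_(nn nu + m) => rsubmx z - F (upd xb (lsubmx z))) i) z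
  = row_mx (- (col i (W nu))^T) (delta_mx 0 i).
Proof.
move=> FE; apply: (@grad_quadratic _ _ _ _ _ (fun=> 0)) => v t.
rewrite /compf mulr0 addr0 mul_row_mx_tr row_mxKl row_mxKr.
have -> : (rsubmx v *m (delta_mx 0 i : 'rV[R]_m)^T) 0 0 = rsubmx v 0 i.
  by rewrite trmx_delta -colE mxE.
have -> : (lsubmx v *m (- (col i (W nu))^T)^T) 0 0 = - (lsubmx v *m W nu) 0 i.
  rewrite linearN /= trmxK mulmxN !mxE; congr (- _); apply: eq_bigr => k _.
  by rewrite !mxE.
have -> : lsubmx (t *: v + z) = t *: lsubmx v + lsubmx z by apply/rowP => k; rewrite !mxE.
have -> : rsubmx (t *: v + z) = t *: rsubmx v + rsubmx z by apply/rowP => k; rewrite !mxE.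
rewrite !FE -[t *: lsubmx v + lsubmx z - xb nu]addrA.
rewrite [(t *: lsubmx v + _) *m _]mulmxDl -scalemxAl.
have subE (A B : 'rV[R]_m) : (A - B) 0 i = A 0 i - B 0 i by rewrite !mxE.
by rewrite !(subE, addmxE, scalemxE); ring.
Qed.

Lemma grad_mpcc_G1 (Qy : 'M[R]_m) (B : forall nu, 'M[R]_(nn nu, m)) (xb : @profile R N nn) nu
    (i : 'I_m) (z : 'rV[R]_(nn nu + m)) :
  grad (compf (mpcc_G1 Qy B xb nu) i) z
  = row_mx (- (col i (B nu *m (invmx Qy)^T))^T) (delta_mx 0 i).
Proof.
apply: (grad_affine_constraint (W := fun nu => B nu *m (invmx Qy)^T) (F := QyBTx Qy B)).
by move=> y; rewrite QyBTx_upd.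
Qed.

Lemma grad_mpcc_G2 (L : forall nu, 'M[R]_(nn nu, m)) (xb : @profile R N nn) nu
    (i : 'I_m) (z : 'rV[R]_(nn nu + m)) :
  grad (compf (mpcc_G2 L xb nu) i) z = row_mx (- (col i (L nu))^T) (delta_mx 0 i).
Proof.
apply: (grad_affine_constraint (W := L) (F := BTx L)).
by move=> y; rewrite BTx_upd.
Qed.

(** With empty index sets for [G1] and [G2] their rows are zero, and the gradients of [mpcc_g] have
    zero [y] block. *)
Lemma rank_grad_family (mg : 'I_N -> nat) (g : forall nu, 'rV[R]_(nn nu) -> 'rV[R]_(mg nu)) nu
    (G1 G2 : 'rV[R]_(nn nu + m) -> 'rV[R]_m) (K : {set 'I_(mg nu)}) (z : 'rV[R]_(nn nu + m)) :
  \rank (grad_family (mpcc_g g nu) G1 G2 K finset.set0 finset.set0 z) =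
  \rank (indic_diag R K *m (\matrix_i grad (compf (g nu) i) (lsubmx z))).
Proof.
rewrite /grad_family.
have -> : (\matrix_(i < m) (if i \in finset.set0 then grad (compf G1 i) z else 0)) = 0
    :> 'M[R]_(m, nn nu + m).
  by apply/matrixP => i j; rewrite !mxE finset.inE mxE.
have -> : (\matrix_(i < m) (if i \in finset.set0 then grad (compf G2 i) z else 0)) = 0
    :> 'M[R]_(m, nn nu + m).
  by apply/matrixP => i j; rewrite !mxE finset.inE mxE.
rewrite !rank_col_mx0 mask_rowsE.
have -> : \matrix_i grad (compf (mpcc_g g nu) i) z =
    row_mx (\matrix_i grad (compf (g nu) i) (lsubmx z)) 0.
  apply/matrixP => i j; rewrite mxE grad_mpcc_g !mxE.
  by case: splitP => k _; rewrite !mxE.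
by rewrite mul_mx_row mulmx0 rank_row_mx0.
Qed.

Lemma MPCC_CRCQ_rank (mg : 'I_N -> nat) (g : forall nu, 'rV[R]_(nn nu) -> 'rV[R]_(mg nu)) nu
    (G1 G2 : 'rV[R]_(nn nu + m) -> 'rV[R]_m) (x : 'rV[R]_(nn nu)) (y : 'rV[R]_m)
    (K : {set 'I_(mg nu)}) :
  MPCC_CRCQ (mpcc_g g nu) G1 G2 (row_mx x y) ->
  K \subset [set i | g nu x 0 i == 0]%SET ->
  \forall x' \near x,
    \rank (indic_diag R K *m (\matrix_i grad (compf (g nu) i) x')) =
    \rank (indic_diag R K *m (\matrix_i grad (compf (g nu) i) x)).
Proof.
move=> [_ crcq] Kact.
have Kact' : K \subset [set i | mpcc_g g nu (row_mx x y) 0 i == 0]%SET.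
  by rewrite /mpcc_g row_mxKl.
have := crcq K finset.set0 finset.set0 Kact' (finset.sub0set _) (finset.sub0set _).
move/nbhs_row_mx; apply: filterS => x'.
by rewrite !rank_grad_family !row_mxKl.
Qed.

End MPCCGradients.

(** * Passage to the limit *)

Section LimitPassage.
Variables (R : realType) (N : nat) (nn : 'I_N -> nat) (m : nat).

Lemma mulmx_row_cvg (T : Type) (F : set_system T) {FF : Filter F} (p q : nat)
    (f : T -> 'rV[R]_p) (A : 'rV[R]_p) (B : 'M[R]_(p, q)) :
  (forall j, f t 0 j @[t --> F] --> A 0 j) ->
  forall i, (f t *m B) 0 i @[t --> F] --> (A *m B) 0 i.
Proof.
move=> fA i; rewrite mxE; under eq_cvg do rewrite mxE.
by apply: cvg_fsum => j; apply: cvgM; [exact: fA|exact: cvg_cst].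
Qed.

Lemma BTx_cvg (T : Type) (F : set_system T) {FF : Filter F} (B : forall nu, 'M[R]_(nn nu, m))
    (xs : T -> @profile R N nn) (xb : @profile R N nn) :
  (forall nu, xs t nu @[t --> F] --> xb nu) ->
  forall i, BTx B (xs t) 0 i @[t --> F] --> BTx B xb 0 i.
Proof.
move=> xscvg i; rewrite summxE; under eq_cvg do rewrite summxE.
apply: cvg_fsum => nu; apply: mulmx_row_cvg => j; exact: cvg_coord.
Qed.

Lemma QyBTx_cvg (T : Type) (F : set_system T) {FF : Filter F} (Qy : 'M[R]_m)
    (B : forall nu, 'M[R]_(nn nu, m)) (xs : T -> @profile R N nn) (xb : @profile R N nn) :
  (forall nu, xs t nu @[t --> F] --> xb nu) ->
  forall i, QyBTx Qy B (xs t) 0 i @[t --> F] --> QyBTx Qy B xb 0 i.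
Proof. by move=> xscvg i; apply: mulmx_row_cvg => j; exact: BTx_cvg. Qed.

Section NepGrad.
Variables (Q : forall nu, 'M[R]_(nn nu)) (c : forall nu, 'rV[R]_(nn nu)).
Variables (a : 'rV[R]_m) (Qy : 'M[R]_m) (B L : forall nu, 'M[R]_(nn nu, m)) (nu : 'I_N).
Let Mp := L nu + B nu *m (invmx Qy)^T.
Let Mm := L nu - B nu *m (invmx Qy)^T.

Lemma nep_gradE (xnu : 'rV[R]_(nn nu)) (psi : 'I_m -> R) l :
  nep_grad Q c a Qy B L xnu psi 0 l =
  \sum_j Q nu l j * xnu 0 j + c nu 0 l + 2^-1 * (Mp *m a^T) l 0
  + 2^-1 * \sum_i a 0 i * psi i * Mm l i.
Proof.
rewrite /nep_grad !(addmxE, scalemxE, trmxE) summxE mxE.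
congr (_ + _ + _ + _ * _); first by apply: eq_bigr => j _; rewrite trmxE.
by apply: eq_bigr => i _; rewrite scalemxE trmxE mxE.
Qed.

Lemma nep_grad_cvg (T : Type) (F : set_system T) {FF : Filter F}
    (x : T -> 'rV[R]_(nn nu)) (xb : 'rV[R]_(nn nu)) (psi : T -> 'I_m -> R) (psib : 'I_m -> R) l :
  x t @[t --> F] --> xb -> (forall i, psi t i @[t --> F] --> psib i) ->
  nep_grad Q c a Qy B L (x t) (psi t) 0 l @[t --> F] --> nep_grad Q c a Qy B L xb psib 0 l.
Proof.
move=> xcvg psicvg; rewrite nep_gradE; under eq_cvg do rewrite nep_gradE.
apply: cvgD.
  apply: cvgD; last exact: cvg_cst.
  apply: cvgD; last exact: cvg_cst.
  by apply: cvg_fsum => j; apply: cvgM; [exact: cvg_cst|exact: cvg_coord].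
apply: cvgM; first exact: cvg_cst.
apply: cvg_fsum => i; apply: cvgM; last exact: cvg_cst.
by apply: cvgM; [exact: cvg_cst|exact: psicvg].
Qed.

(** Bounded slopes suffice here, before any convergence of slopes is known; [D] makes the multiplier
    bound independent of the index. *)
Lemma nep_grad_near_bounded (T : Type) (F : set_system T) {FF : Filter F}
    (x : T -> 'rV[R]_(nn nu)) (xb : 'rV[R]_(nn nu)) (psi : T -> 'I_m -> R) (b : R) :
  x t @[t --> F] --> xb -> (\forall t \near F, forall i, `|psi t i| <= b) ->
  exists2 D : R, 0 <= D & \forall t \near F, `|nep_grad Q c a Qy B L (x t) (psi t)| <= D.
Proof.
move=> xcvg psib.
pose base (y : 'rV[R]_(nn nu)) (l : 'I_(nn nu)) : R := nep_grad Q c a Qy B L y (fun=> 0) 0 l.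
pose S l : R := \sum_i `|a 0 i * Mm l i|.
have gradE (y : 'rV[R]_(nn nu)) p l : nep_grad Q c a Qy B L y p 0 l = base y l + 2^-1 * \sum_i a 0 i * p i * Mm l i.
  rewrite /base !nep_gradE /=.
  have -> : \sum_i a 0 i * 0 * (L nu - B nu *m (invmx Qy)^T) l i = 0.
    by apply: big1 => i _; rewrite mulr0 mul0r.
  by rewrite mulr0 addr0.
exists (\sum_l (`|base xb l| + 1 + 2^-1 * (`|b| * S l))).
  apply: sumr_ge0 => l _; rewrite !addr_ge0 // !mulr_ge0 //.
  by apply: sumr_ge0.
have basenear : \forall t \near F, forall l, `|base (x t) l| < `|base xb l| + 1.
  apply: filter_forall => l; apply: (cvgr_lt (`|base xb l|)); last by rewrite ltrDl.
  by apply: cvg_norm; apply: nep_grad_cvg => // i; exact: cvg_cst.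
apply: filterS2 psib basenear => t psit baset.
have termge0 l : 0 <= `|base xb l| + 1 + 2^-1 * (`|b| * S l).
  rewrite !addr_ge0 // !mulr_ge0 //; apply: sumr_ge0 => *; exact: normr_ge0.
apply: mx_norm_leP => [|i l]; first by apply: sumr_ge0.
rewrite ord1 gradE (bigD1 l) //= -[leLHS]addr0 lerD //; last by apply: sumr_ge0.
apply: le_trans (ler_normD _ _) _; apply: lerD; first exact: ltW.
rewrite normrM gtr0_norm ?invr_gt0 // ler_wpM2l ?invr_ge0 // /S mulr_sumr.
apply: le_trans (ler_norm_sum _ _ _) _; apply: ler_sum => k _.
rewrite mulrAC normrM mulrC ler_wpM2r //.
by apply: le_trans (psit k) (ler_norm b).
Qed.

End NepGrad.
End LimitPassage.

(** * Bounded multipliers along the sequence and stationarity of the limit *)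

Theorem mainTheorem7 (R : realType) (N : nat) (nn : 'I_N -> nat) (m : nat)
  (Q : forall nu, 'M[R]_(nn nu)) (c : forall nu, 'rV[R]_(nn nu))
  (mg : 'I_N -> nat) (g : forall nu, 'rV[R]_(nn nu) -> 'rV[R]_(mg nu))
  (a : 'rV[R]_m) (Qy : 'M[R]_m) (B L : forall nu, 'M[R]_(nn nu, m))
  (phit : R -> R -> R) (eps : nat -> R) (xs : nat -> @profile R N nn) (xbar : @profile R N nn) :
  (* Q_nu symmetric positive definite *)
  (forall nu, (Q nu)^T = Q nu) ->
  (forall nu (v : 'rV[R]_(nn nu)), v != 0 -> 0 < (v *m Q nu *m v^T) 0 0) ->
  (* g_nu convex (componentwise) and at least twice differentiable *)
  (forall nu i (x y : 'rV[R]_(nn nu)) (t : R), 0 <= t <= 1 ->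
     g nu (t *: x + (1 - t) *: y) 0 i <= t * g nu x 0 i + (1 - t) * g nu y 0 i) ->
  (forall nu (x : 'rV[R]_(nn nu)), differentiable (g nu) x) ->
  (forall nu i (x : 'rV[R]_(nn nu)), differentiable (grad (compf (g nu) i)) x) ->
  (* X_nu nonempty *)
  (forall nu, exists x : 'rV[R]_(nn nu), forall i, g nu x 0 i <= 0) ->
  (* a >= 0 *)
  (forall i, 0 <= a 0 i) ->
  (* Q_y positive definite diagonal *)
  is_diag_mx Qy -> (forall i, 0 < Qy i i) ->
  (* smoothing function phit_eps: convex, twice differentiable for eps > 0,
     continuous in eps, and phit_eps(t) -> |t| as eps -> 0+ *)
  (forall e, 0 < e -> forall (s t u : R), 0 <= u <= 1 ->
     phit e (u * s + (1 - u) * t) <= u * phit e s + (1 - u) * phit e t) ->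
  (forall e, 0 < e -> forall t, derivable (phit e) t 1) ->
  (forall e, 0 < e -> forall t, derivable (derive1 (phit e)) t 1) ->
  (forall t e, 0 < e -> {for e, continuous (fun e' => phit e' t)}) ->
  (forall t, phit e t @[e --> 0^'+] --> `|t|) ->
  (* NEP(eps) has a unique Nash equilibrium for every eps > 0 *)
  (forall e, 0 < e -> forall x1 x2, is_NE Q c g a Qy B L phit e x1 ->
                                    is_NE Q c g a Qy B L phit e x2 -> x1 = x2) ->
  (* eps_k > 0, eps_k -> 0, xs k = x*(eps_k), x*(eps_k) -> xbar *)
  (forall k, 0 < eps k) ->
  eps @ \oo --> (0 : R) ->
  (forall k, is_NE Q c g a Qy B L phit (eps k) (xs k)) ->
  (forall nu, (fun k => xs k nu) @ \oo --> xbar nu) ->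
  (* MPCC-CRCQ for MPCC_nu (x_{-nu} = xbar_{-nu}) at (xbar_nu, ybar) *)
  (forall nu, MPCC_CRCQ (mpcc_g g nu) (mpcc_G1 Qy B xbar nu) (mpcc_G2 L xbar nu)
                (row_mx (xbar nu) (ybar Qy B L xbar))) ->
  forall nu,
    (exists lam : nat -> 'rV[R]_(mg nu),
       (exists M : R, forall k i, `|lam k 0 i| <= M) /\
       \forall k \near \oo, NEP_KKT Q c g a Qy B L phit (eps k) (xs k) (lam k))
    /\ strongly_stationary (mpcc_f Q c a nu) (mpcc_g g nu)
         (mpcc_G1 Qy B xbar nu) (mpcc_G2 L xbar nu)
         (row_mx (xbar nu) (ybar Qy B L xbar)).
Proof.
move=> Qsym _ gconv gdiff gdiff2 _ a_ge0 _ _ phiconv phider _ _ phicvg _ eps_gt0 eps0 NE xscvg crcq nu.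
pose V x := \matrix_i grad (compf (g nu) i) x.
pose A := [set i | g nu (xbar nu) 0 i == 0]%SET.
have gradcont (x : 'rV[R]_(nn nu)) i l :
    {for x, continuous (fun x => grad (compf (g nu) i) x 0 l)}.
  have gradx := differentiable_continuous (gdiff2 nu i x).
  exact: (@cvg_coord R _ (nbhs x) _ 1 _ (grad (compf (g nu) i)) _ 0 l gradx).
have [M M_ge0 reduction] : exists2 M : R, 0 <= M &
    \forall x \near xbar nu, has_bounded_reductions (V x) A M.
  apply: near_bounded_reductions => [i j|K KA].
    have VE : (fun x => V x i j) = (fun x => grad (compf (g nu) i) x 0 j).
      by apply/funext => x; rewrite /V mxE.
    by rewrite VE; exact: gradcont.
  exact: (MPCC_CRCQ_rank (crcq nu)).
pose t i := (BTx L xbar - QyBTx Qy B xbar) 0 i.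
pose tk k i := (BTx L (xs k) - QyBTx Qy B (xs k)) 0 i.
pose psi k i := derive1 (phit (eps k)) (tk k i).
have tkE k i : tk k i = BTx L (xs k) 0 i - QyBTx Qy B (xs k) 0 i by rewrite /tk !mxE.
have tE i : t i = BTx L xbar 0 i - QyBTx Qy B xbar 0 i by rewrite /t !mxE.
have tcvg (F : set_system nat) (FF : Filter F) : \oo `<=` F -> forall i, tk k i @[k --> F] --> t i.
  move=> leF i; rewrite tE; under eq_cvg do rewrite tkE.
  have xsF nu' : xs k nu' @[k --> F] --> xbar nu'.
    by apply: cvg_trans (xscvg nu'); exact: cvg_app.
  by apply: cvgB; [exact: BTx_cvg|exact: QyBTx_cvg].
have tcvgoo i : tk k i @[k --> \oo] --> t i by exact: tcvg.
(* Any bound above 1 would do. *)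
have psib : \forall k \near \oo, forall i, `|psi k i| <= 2.
  apply: filter_forall => i.
  by apply: (smoothing_derive_bounded _ phiconv phider phicvg eps_gt0 eps0 (tcvgoo i)); rewrite ltr1n.
have [D D_ge0 dbound] := nep_grad_near_bounded Q c a Qy B L (xscvg nu) psib.
have xsfeas k i : g nu (xs k nu) 0 i <= 0 by have [] := NE k nu.
have nearKKT : \forall k \near \oo, exists lam : 'rV[R]_(mg nu),
    NEP_KKT Q c g a Qy B L phit (eps k) (xs k) lam /\ forall i, `|lam 0 i| <= M * D.
  have reductionk : \forall k \near \oo, \forall x \near xs k nu, has_bounded_reductions (V x) A M.
    exact: (xscvg nu _ (near_join reduction)).
  (* Constraints inactive at the limit are eventually inactive at [xs k nu], so the active set [A]
     of the limit serves all late indices. *)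
  have activek : \forall k \near \oo, forall i, i \notin A -> g nu (xs k nu) 0 i < 0.
    apply: filter_forall => i; have [iA|iA] := boolP (i \in A); first by apply: nearW.
    have gi : g nu (xbar nu) 0 i < 0.
      rewrite lt_neqAle; move: iA; rewrite finset.inE => -> /=.
      have [] := (crcq nu).1; rewrite /mpcc_g row_mxKl => gle _; exact: gle.
    have gicvg : g nu (xs k nu) 0 i @[k --> \oo] --> g nu (xbar nu) 0 i.
      apply: cvg_coord.
      exact: (cvg_comp _ (g nu) (xscvg nu) (differentiable_continuous (gdiff nu (xbar nu)))).
    by apply: filterS (cvgr_lt _ gicvg _ gi).
  apply: filterS3 reductionk activek dbound => k redk actk dk.
  have vi y : (forall i, g nu y 0 i <= 0) ->
      0 <= \sum_l nep_grad Q c a Qy B L (xs k nu) (psi k) 0 l * (y 0 l - xs k nu 0 l).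
    move=> yfeas.
    exact: (NE_variational_inequality (Qsym nu) (gconv nu) (phider _ (eps_gt0 k)) (NE k) yfeas).
  have [lam [lam_ge0 lamg stat lamb]] :=
    penalty_kkt (gdiff nu) (gradcont (xs k nu)) (xsfeas k) vi actk redk.
  exists lam; split; last first.
    by move=> i; apply: le_trans (lamb i) _; rewrite ler_wpM2l.
  split=> [|i]; first exact: stat.
  have := lamg i => /eqP; rewrite mulf_eq0 => /orP[]/eqP ->.
    by rewrite min_l // oppr_ge0.
  by rewrite oppr0 min_r.
(* Early indices without a bounded multiplier receive 0, so the bound holds for every [k] and the
   KKT system from some index on. *)
have /choice[lam lamP] : forall k, exists lam : 'rV[R]_(mg nu), (forall i, `|lam 0 i| <= M * D) /\
    ((exists lam : 'rV[R]_(mg nu), NEP_KKT Q c g a Qy B L phit (eps k) (xs k) lam /\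
       forall i, `|lam 0 i| <= M * D) -> NEP_KKT Q c g a Qy B L phit (eps k) (xs k) lam).
  move=> k; have [[lam [kkt lamb]]|no] := pselect (exists lam : 'rV[R]_(mg nu),
      NEP_KKT Q c g a Qy B L phit (eps k) (xs k) lam /\ forall i, `|lam 0 i| <= M * D).
    by exists lam.
  by exists 0; split=> // i; rewrite mxE normr0 mulr_ge0.
have kktk : \forall k \near \oo, NEP_KKT Q c g a Qy B L phit (eps k) (xs k) (lam k).
  by apply: filterS nearKKT => k; exact: (lamP k).2.
split.
  by exists lam; split=> //; exists (M * D) => k i; exact: (lamP k).1.
split; first exact: (crcq nu).1.
(* Along one ultrafilter finer than [\oo] all slopes and multipliers converge together. *)
have [U [UU leU]] := @ultraFilterLemma _ \oo _.
have UP := @ultra_proper _ _ UU.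
have epsU : eps k @[k --> U] --> (0 : R) by apply: cvg_trans eps0; exact: cvg_app.
have xsU : xs k nu @[k --> U] --> xbar nu by apply: cvg_trans (xscvg nu); exact: cvg_app.
have tU i : tk k i @[k --> U] --> t i by exact: tcvg.
have /choice[psib' psiU] : forall i, exists p : R, psi k i @[k --> U] --> p.
  move=> i; apply: (@ultra_bounded_cvg R _ U _ 2) => //.
  by apply: filterS (leU _ psib) => k; exact.
have /choice[lamb lamU] : forall i, exists p : R, lam k 0 i @[k --> U] --> p.
  move=> i; apply: (@ultra_bounded_cvg R _ U _ (M * D)) => //.
  by apply: nearW => k; exact: (lamP k).1.
have kktU := leU _ kktk.
have psiP i := smoothing_derive_cvg UP phiconv phider phicvg eps_gt0 epsU (tU i) (psiU i).
have psi1 i : -1 <= psib' i <= 1 by rewrite -ler_norml; have [] := psiP i.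
have limeq l : nep_grad Q c a Qy B L (xbar nu) psib' 0 l
    + \sum_i lamb i * grad (compf (g nu) i) (xbar nu) 0 l = 0.
  have lim : nep_grad Q c a Qy B L (xs k nu) (psi k) 0 l
      + \sum_i lam k 0 i * grad (compf (g nu) i) (xs k nu) 0 l @[k --> U] -->
      nep_grad Q c a Qy B L (xbar nu) psib' 0 l
      + \sum_i lamb i * grad (compf (g nu) i) (xbar nu) 0 l.
    apply: cvgD; first exact: nep_grad_cvg.
    apply: cvg_fsum => i; apply: cvgM; first exact: lamU.
    exact: (cvg_comp (fun k => xs k nu) _ xsU (gradcont (xbar nu) i l)).
  apply: (cvg_near_eq UP lim); apply: filterS kktU => k [stat _].
  have := congr1 (fun v : 'rV[R]_(nn nu) => v 0 l) stat.
  rewrite addmxE summxE [RHS]mxE => statl; rewrite -[RHS]statl; congr (_ + _).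
  by apply: eq_bigr => i _; rewrite scalemxE.
(* The sum of the two is [a], as the [y] block requires, and [Ga2 - Ga1] is [a] times the limit
   slope, as the [x] block requires. *)
pose Ga1 : 'rV[R]_m := \row_i (2^-1 * a 0 i * (1 - psib' i)).
pose Ga2 : 'rV[R]_m := \row_i (2^-1 * a 0 i * (1 + psib' i)).
have Ga1E i : Ga1 0 i = 2^-1 * a 0 i * (1 - psib' i) by rewrite mxE.
have Ga2E i : Ga2 0 i = 2^-1 * a 0 i * (1 + psib' i) by rewrite mxE.
have xb : lsubmx (row_mx (xbar nu) (ybar Qy B L xbar)) = xbar nu by rewrite row_mxKl.
have updx : upd xbar (xbar nu) = xbar.
  apply: functional_extensionality_dep => mu.
  rewrite /upd; have [<-|ne] := eqVneq nu mu; first by rewrite dfwithin.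
  by rewrite dfwithout.
have G1E i : mpcc_G1 Qy B xbar nu (row_mx (xbar nu) (ybar Qy B L xbar)) 0 i =
    Num.max (QyBTx Qy B xbar 0 i) (BTx L xbar 0 i) - QyBTx Qy B xbar 0 i.
  by rewrite /mpcc_G1 row_mxKl row_mxKr updx !mxE.
have G2E i : mpcc_G2 L xbar nu (row_mx (xbar nu) (ybar Qy B L xbar)) 0 i =
    Num.max (QyBTx Qy B xbar 0 i) (BTx L xbar 0 i) - BTx L xbar 0 i.
  by rewrite /mpcc_G2 row_mxKl row_mxKr updx !mxE.
exists (\row_i lamb i), Ga1, Ga2; split; [|split; [|split; [|split]]].
- apply/rowP => j; rewrite grad_mpcc_f // xb [RHS]mxE.
  have subE (u v : 'rV[R]_(nn nu + m)) : (u - v) 0 j = u 0 j - v 0 j by rewrite !mxE.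
  rewrite 2!subE addmxE !summxE.
  under eq_bigr do rewrite grad_mpcc_g xb scalemxE mxE.
  under [X in _ - X - _]eq_bigr do rewrite grad_mpcc_G1 scalemxE Ga1E.
  under [X in _ - X]eq_bigr do rewrite grad_mpcc_G2 scalemxE Ga2E.
  case: (split_ordP j) => l ->; rewrite ?row_mxEl ?row_mxEr.
    rewrite -[RHS](limeq l) nep_gradE.
    under eq_bigr do rewrite row_mxEl.
    under [X in _ - X - _]eq_bigr do rewrite row_mxEl.
    under [X in _ - X]eq_bigr do rewrite row_mxEl.
    rewrite addmxE trmxE mxE; move: (B nu *m (invmx Qy)^T) => W.
    (* The terms in [L nu + W] and [L nu - W] are regrouped by [W] and [L nu], whose coefficients
       are [Ga1] and [Ga2]. *)
    have key : 2^-1 * ((L nu + W) *m a^T) l 0 + 2^-1 * \sum_i a 0 i * psib' i * (L nu - W) l i =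
        - \sum_i 2^-1 * a 0 i * (1 - psib' i) * (- (col i W)^T) 0 l
        - \sum_i 2^-1 * a 0 i * (1 + psib' i) * (- (col i (L nu))^T) 0 l.
      rewrite mxE !mulr_sumr -!sumrN -!big_split /=; apply: eq_bigr => i _.
      by rewrite !mxE; field.
    have -> : \sum_k Q nu l k * (xbar nu)^T k 0 = \sum_k Q nu l k * xbar nu 0 k.
      by apply: eq_bigr => k _; rewrite trmxE.
    by move: key; lra.
  under eq_bigr do rewrite row_mxEr mxE mulr0.
  under [X in _ - X - _]eq_bigr do rewrite row_mxEr.
  under [X in _ - X]eq_bigr do rewrite row_mxEr.
  have deltaE (k : 'I_m -> R) : \sum_i k i * (delta_mx 0 i : 'rV[R]_m) 0 l = k l.
    rewrite (bigD1 l) //= mxE !eqxx mulr1 big1 ?addr0 // => i /negPf il.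
    by rewrite mxE eqxx eq_sym il mulr0.
  rewrite big1 // (deltaE (fun i => 2^-1 * a 0 i * (1 - psib' i))).
  by rewrite (deltaE (fun i => 2^-1 * a 0 i * (1 + psib' i))); field.
- move=> i; rewrite mxE; apply: (cvgr_to_ge (lamU i)).
  apply: filterS kktU => k [_ /(_ i)] /esym min0.
  by rewrite [leLHS]min0 ge_min lexx.
- move=> i; rewrite /mpcc_g xb mxE.
  have gU : lam k 0 i * g nu (xs k nu) 0 i @[k --> U] --> lamb i * g nu (xbar nu) 0 i.
    apply: cvgM => //; apply: cvg_coord.
    exact: (cvg_comp _ (g nu) xsU (differentiable_continuous (gdiff nu (xbar nu)))).
  apply: (cvg_near_eq UP gU); apply: filterS kktU => k [_ /(_ i)].
  have [_ ->|_ /eqP] := leP (lam k 0 i) (- g nu (xs k nu) 0 i); first by rewrite mul0r.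
  by rewrite oppr_eq0 => /eqP ->; rewrite mulr0.
(* If [t i] is nonzero, the limit slope is its sign and the multiplier of the constraint with
   positive value vanishes; at a tie both constraint values are zero. *)
- move=> i; have [_ psipos psineg] := psiP i; rewrite tE in psipos psineg.
  rewrite G1E G2E Ga1E Ga2E.
  have [lt_|lt_|eq_] := ltgtP (QyBTx Qy B xbar 0 i) (BTx L xbar 0 i).
  + by rewrite psipos ?subr_gt0 // !subrr !mulr0 mul0r.
  + by rewrite psineg ?subr_lt0 // !subrr !mulr0 mul0r.
  + by rewrite eq_ !subrr !mul0r.
- move=> i _ _; rewrite Ga1E Ga2E.
  have /andP[p1 p2] := psi1 i.
  by split; rewrite !mulr_ge0 ?invr_ge0 //; lra.
Qed.
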